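(* Let $\theta\ge2$. Let $\Phi$ be a strictly convex nice Young function such that, on $(0,+\infty)$, $\frac{\Phi(x)}{x^2}$ is non-decreasing and $\frac{\Phi(x)}{x^\theta}$ is non-increasing. Let $\mu$ be a probability measure on $\mathbb R$ with median $m$, and let $d\nu(x)=n(x)\,dx$ be a measure on $\mathbb R$. Assume that they satisfy a Poincaré inequality with constant $C_P$: every locally Lipschitz $f:\mathbb R\to\mathbb R$ satisfies $\mathbf{Var}_\mu(f)\le C_P\int(f')^2\,d\nu$. Then for every locally Lipschitz function $f$ on $\mathbb R$, $$\mathbf{Ent}_\mu(f^2)\le\Big(235\,C_P+16\,\theta\,\Phi(1)\max\big(C_-(\Phi),C_+(\Phi)\big)\Big)\int_{\mathbb R}H_\Phi\left(\frac{f'}{f}\right)f^2\,d\nu,$$ with $$C_+(\Phi):=\sup_{x>m}\mu\big([x,+\infty)\big)\log\Big(\frac{1}{\mu([x,+\infty))}\Big)\left\|\frac{\mathbf 1_{[m,x]}}{n}\right\|_{2{\Phi'_r}^{-1}},$$ $$C_-(\Phi):=\sup_{x<m}\mu\big((-\infty,x]\big)\log\Big(\frac{1}{\mu((-\infty,x])}\Big)\left\|\frac{\mathbf 1_{[x,m]}}{n}\right\|_{2{\Phi'_r}^{-1}}.$$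
   Context: A nice Young function is an even convex function $\Phi:\mathbb R\to[0,+\infty)$ with $\Phi(0)=0$, $\Phi'(0)=0$, $\lim_{x\to+\infty}\Phi(x)/x=+\infty$, vanishing only at $0$. Its modification is $H_\Phi(x)=x^2$ if $|x|\le1$ and $H_\Phi(x)=\Phi(|x|)/\Phi(1)$ if $|x|>1$. $\Phi'_r$ is the right derivative of $\Phi$ on $\mathbb R^+$, and ${\Phi'_r}^{-1}(u):=\inf\{y\ge0:\ \Phi'_r(y)\ge u\}$ is its left inverse. For a non-decreasing function $\Psi$ on $\mathbb R^+$ with limits $0$ at $0$ and $+\infty$ at $+\infty$ (not necessarily convex) and a measurable function $g$ on $\mathbb R$, $\|g\|_\Psi:=\inf\{\delta>0:\ \int_{\mathbb R}\Psi(|g(t)|/\delta)\,dt\le1\}$ (Lebesgue integral, $\inf\emptyset=+\infty$); it need not be a norm. $\mathbf{Ent}_\mu(g)=\int g\log g\,d\mu-(\int g\,d\mu)\log(\int g\,d\mu)$ and $\mathbf{Var}_\mu(f)=\int f^2d\mu-(\int f\,d\mu)^2$. For a locally Lipschitz $f$, $|f'|(x)=\lim_{r\to0^+}\sup_{|x-y|\le r}\frac{|f(x)-f(y)|}{|x-y|}$, equal almost everywhere to the absolute value of the usual derivative; only $|f'|$ matters since $H_\Phi$ is even. The integrand $H_\Phi(f'/f)f^2$ is read as $0$ at points where $f=0$ (where $f'=0$ almost everywhere). Conventions: $0\log(1/0)=0$, $0\cdot\infty=0$, $1/n=+\infty$ where $n=0$. *)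

(* Defs.v *)
From HB Require Import structures.
From mathcomp Require Import all_boot all_order all_algebra.
From mathcomp Require Import all_classical all_reals all_analysis.

Set Implicit Arguments.
Unset Strict Implicit.
Unset Printing Implicit Defensive.

Import Order.TTheory GRing.Theory Num.Theory.
Import numFieldNormedType.Exports.

Local Open Scope classical_set_scope.
Local Open Scope ring_scope.

Section young.
Context {R : realType}.
Implicit Types (Phi : R -> R).

Record nice_young Phi : Prop := NiceYoung {
  young_even : forall x, Phi (- x) = Phi x;
  young_convex : convex_function [set: R] Phi;
  young_ge0 : forall x, 0 <= Phi x;
  young_at0 : Phi 0 = 0;
  young_derive0 : is_derive (0 : R) (1 : R) Phi 0;
  young_superlinear : Phi x / x @[x --> +oo] --> +oo;
  young_eq0 : forall x, Phi x = 0 -> x = 0 }.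

Definition strictly_convex Phi : Prop :=
  forall (t x y : R), 0 < t < 1 -> x != y ->
    Phi (t * x + (1 - t) * y) < t * Phi x + (1 - t) * Phi y.

(* the modification H_Phi *)
Definition young_mod Phi (x : R) : R :=
  if `|x| <= 1 then x ^+ 2 else Phi `|x| / Phi 1.

Definition right_derive Phi (y : R) : R :=
  lim (h^-1 * (Phi (y + h) - Phi y) @[h --> 0^'+]).

(* Left inverse of the right derivative. The argument is extended so that the
   value at +oo (the infimum of the empty set) is +oo; this value is needed on
   the set where 1/n = +oo. *)
Definition right_derive_inv Phi (u : \bar R) : \bar R :=
  ereal_inf [set y%:E | y in [set y : R |
    (0 <= y) /\ (u <= (right_derive Phi y)%:E)%E]].

Local Open Scope ereal_scope.

Definition orlicz_norm (Psi : \bar R -> \bar R) (g : R -> \bar R) : \bar R :=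
  ereal_inf [set d%:E | d in [set d : R | (0 < d)%R /\
    \int[lebesgue_measure]_t Psi (`|g t| * (d^-1)%:E) <= 1]].

(* 1_A / n, with 1 / 0 = +oo and 0 * +oo = 0 *)
Definition indic_over (A : set R) (n : R -> R) (t : R) : \bar R :=
  (\1_A t)%:E * (n t)%:E^-1.

End young.

Section slope.
Context {R : realType}.

Definition locally_lipschitz (f : R -> R) : Prop :=
  forall x : R, exists2 V : set R, nbhs x V & [lipschitz f z | z in V].

(* |f'|; for a locally Lipschitz f the limit is finite, so that fine loses
   nothing *)
Definition abs_slope (f : R -> R) (x : R) : R :=
  fine (lim (ereal_sup [set (`|f x - f y| / `|x - y|)%:E |
                         y in [set y : R | 0 < `|x - y| <= r]]
             @[r --> (0:R)^'+])).

End slope.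

Section functional_inequalities.
Context {R : realType}.
Local Open Scope ereal_scope.

(* Entropy of g >= 0. When g is not integrable, the defining expression is the
   meaningless +oo - +oo, and the entropy is taken to be +oo. The negative part
   of g log g is bounded; ln 0 = 0 gives 0 log 0 = 0. *)
Definition Ent d (T : measurableType d) (mu : probability T R) (g : T -> R)
    : \bar R :=
  if \int[mu]_x (g x)%:E == +oo then +oo
  else \int[mu]_x (g x * ln (g x))%:E
       - (fine (\int[mu]_x (g x)%:E) * ln (fine (\int[mu]_x (g x)%:E)))%:E.

Context (mu : probability (measurableTypeR R) R).

Definition median (m : R) : Prop :=
  (2^-1)%:E <= mu `]-oo, m]%classic /\ (2^-1)%:E <= mu `[m, +oo[%classic.

(* 'V_mu[f] is int f^2 - (int f)^2 for f in L^2(mu) (varianceE), and +oo for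
   the other measurable f. *)
Definition poincare (nu : {measure set (measurableTypeR R) -> \bar R}) (C : R)
    : Prop :=
  forall f : R -> R, locally_lipschitz f ->
    'V_mu[f] <= C%:E * \int[nu]_x (abs_slope f x ^+ 2)%:E.

Definition xlogV (p : R) : R := p * ln p^-1.

Definition C_plus (Phi n : R -> R) (m : R) : \bar R :=
  ereal_sup [set (xlogV (fine (mu `[x, +oo[%classic)))%:E *
      orlicz_norm (fun u => 2%:E * right_derive_inv Phi u)
                  (indic_over `[m, x]%classic n)
    | x in [set x : R | (m < x)%R]].

Definition C_minus (Phi n : R -> R) (m : R) : \bar R :=
  ereal_sup [set (xlogV (fine (mu `]-oo, x]%classic)))%:E *
      orlicz_norm (fun u => 2%:E * right_derive_inv Phi u)
                  (indic_over `[x, m]%classic n)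
    | x in [set x : R | (x < m)%R]].

(* int H_Phi(f'/f) f^2 dnu; the integrand is 0 where f = 0, as z / 0 = 0 *)
Definition young_energy (nu : {measure set (measurableTypeR R) -> \bar R})
    (Phi f : R -> R) : \bar R :=
  \int[nu]_x (young_mod Phi (abs_slope f x / f x) * f x ^+ 2)%:E.

End functional_inequalities.

(* Main.v *)
Require Import Defs.
From HB Require Import structures.
From mathcomp Require Import all_boot all_order all_algebra.
From mathcomp Require Import all_classical all_reals all_analysis.
From mathcomp Require Import measurable_realfun lra ring.

Set Implicit Arguments.
Unset Strict Implicit.
Unset Printing Implicit Defensive.

Import Order.TTheory GRing.Theory Num.Theory.
Import numFieldNormedType.Exports.

Local Open Scope classical_set_scope.
Local Open Scope ring_scope.

(* Normalise f so that int f^2 dmu = 1.  Pointwise, x^2 ln x^2 - x^2 + 1 is at most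
   33 (x - 1)^2 plus a sum over dyadic levels b = 2^j >= 16 of 4 b^2 ln b^2 1_{x >= b}.
   The quadratic term integrates to at most 66 times the variance of |f|, which
   Poincare's inequality controls.  For a level b, |f| has to cross the strip
   (b/4, b) between m and the part of {|f| >= b} on a given side of m, or between m
   and a point beyond which mu still has mass at least 1/4, as mu {|f| > b/4} <= 1/4.
   Young's inequality bounds the energy of such a crossing on [m, x] below by
   b^2 / (4 Phi(1) ||1_[m,x]/n||), and the definition of C_+ and C_- turns this into
   mu {|f| >= b} b^2 ln b^2 <= 4 Phi(1) C_+- energy (b/4 < |f| < b).  Each point lies in
   at most two of these strips, hence the constant 4 * 4 * 2 Phi(1) <= 16 theta Phi(1). *)


(** * Local Lipschitz functions and their slopes *)

(** The difficulty in comparing masses is that p ln (1/p) is not monotone: it decreases beyond 1/e,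
    while a tail on one side of the median may have any mass up to 1/2. The function takes the same
    value at 1/4 and at 1/2, and its value at p <= 1/4 is at most its value anywhere on [p, 1/2].
    Hence the two thresholds: 1/2 comes from the median, and 1/4 is what Markov's inequality must
    give at height b/4. The quadratic term is centred at the L2 norm K of f, not at the mean A of
    |f|: the integral of (|f| - K)^2 is 2 K (K - A), at most twice the variance K^2 - A^2. Of the
    slope of f, the crossing argument uses only that its integral over an interval bounds the
    increment of f. This follows from Lebesgue points of the slope and a compactness argument,
    without differentiating f. Poincare's inequality cannot be applied to |f| directly, because the
    energy integrand is 0 where f = 0 while the slope may be positive there; it is applied to the
    truncations max(|f| - e, 0), and e tends to 0. *)

Section real_line.
Context {R : realType}.
Implicit Types (f : R -> R) (a b c x y r k d e : R).

(** Compactness of a segment in the form of Cousin's lemma: the supremum of the points reachable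
    from [a] can be stepped over by the local hypothesis, so it must be [b]. It glues local
    increment bounds whose radii are not uniform. *)
Lemma cousin (P : R -> R -> Prop) :
  (forall a b c, a <= b -> b <= c -> P a b -> P b c -> P a c) ->
  (forall x, exists2 d, 0 < d & forall u v, x - d < u -> u <= x -> x <= v ->
     v < x + d -> P u v) ->
  forall a b, a <= b -> P a b.
Proof.
move=> Ptrans Ploc a b ab.
pose S := [set x | [/\ a <= x, x <= b & P a x]].
have Sa : S a.
  by have [d d0 Pd] := Ploc a; split => //; apply: Pd; rewrite ?gtrBl ?ltrDl.
have hsS : has_sup S by split; [exists a|exists b => x []].
have aS : a <= sup S by apply: sup_upper_bound.
have Sb : sup S <= b by apply: ge_sup; [exists a|move=> x []].
have [d d0 Pd] := Ploc (sup S).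
have [x [ax xb Pax] xS] := sup_adherent d0 hsS.
have xS' : x <= sup S by apply: sup_upper_bound.
(* [v] lies strictly beyond [sup S] unless it is [b], yet it is reachable; so [v = b]. *)
pose v := Num.min b (sup S + d / 2).
have Sv : sup S <= v by rewrite le_min Sb/=; lra.
have vd : v < sup S + d by rewrite gt_min; apply/orP; right; lra.
have vb : v <= b by rewrite ge_min lexx.
have Pav : P a v.
  apply: (Ptrans _ x) => //; first exact: le_trans xS' Sv.
  exact: Pd.
have : v <= sup S by apply: sup_upper_bound => //; split => //; exact: le_trans Sv.
rewrite {1}/v ge_min => /orP[bS|]; last lra.
by suff -> : b = v by []; apply/eqP; rewrite eq_le vb andbT (le_trans bS).
Qed.

Lemma locally_lipschitzP f : locally_lipschitz f <-> forall x, exists k d,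
  [/\ 0 <= k, 0 < d & forall y z, `|x - y| < d -> `|x - z| < d ->
    `|f y - f z| <= k * `|y - z|].
Proof.
split=> [H x|H x].
  have [V /nbhs_ballP[d /= d0 dV] lipV] := H x.
  have [k [k0 Hk]] : exists k, 0 <= k /\ k.-lipschitz_V f.
    near (pinfty_nbhs R) => k; exists k; split; first by near: k; exact: nbhs_pinfty_ge.
    near: k; exact: lipV.
  exists k, d; split => // y z xy xz.
  by apply: (Hk (y, z)); split => /=; apply: dV.
have [k [d [k0 d0 Hk]]] := H x.
exists (ball x d); first exact: nbhsx_ballx.
have pf : ProperFilter (globally (ball x d `*` ball x d)).
  by apply: (@globally_properfilter _ _ (x, x)); split; exact: ballxx.
apply: (@klipschitzW _ _ _ k) => -[y z] [/= xy xz]; exact: Hk.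
Unshelve. all: by end_near. Qed.

Lemma locally_lipschitz_continuous f : locally_lipschitz f -> continuous f.
Proof.
move=> /locally_lipschitzP H x; have [k [d [k0 d0 Hk]]] := H x.
apply/cvgrPdist_le => e e0.
near=> t.
have xt : `|x - t| < d by near: t; exact: cvgr_dist_lt.
apply: (le_trans (Hk x t _ xt)); first by rewrite subrr normr0.
rewrite (@le_trans _ _ ((k + 1) * `|x - t|))//; first by rewrite ler_wpM2r// lerDl.
rewrite mulrC -ler_pdivlMr ?ltr_wpDl//.
near: t; apply: cvgr_dist_le => //; by rewrite divr_gt0// ltr_wpDl.
Unshelve. all: by end_near. Qed.

Lemma locally_lipschitz_comp f (g : R -> R) :
  (forall x y, `|g x - g y| <= `|x - y|) ->
  locally_lipschitz f -> locally_lipschitz (g \o f).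
Proof.
move=> g1 /locally_lipschitzP H; apply/locally_lipschitzP => x.
have [k [d [k0 d0 Hk]]] := H x; exists k, d; split => // y z xy xz.
exact: le_trans (g1 _ _) (Hk _ _ _ _).
Qed.

Let sl f x r : \bar R := ereal_sup [set (`|f x - f y| / `|x - y|)%:E |
                         y in [set y : R | 0 < `|x - y| <= r]].

Lemma slope_set_neq0 x r : 0 < r -> 0 < `|x - (x + r)| <= r.
Proof. by move=> r0; rewrite opprD addrA subrr sub0r normrN gtr0_norm// r0 lexx. Qed.

Let slP f x r k : 0 < r -> (sl f x r <= k%:E)%E <->
  forall y, `|x - y| <= r -> `|f x - f y| <= k * `|x - y|.
Proof.
move=> r0; split=> H.
  move=> y xyr; have [->|xy] := eqVneq x y; first by rewrite !subrr !normr0 mulr0.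
  have xy0 : 0 < `|x - y| by rewrite normr_gt0 subr_eq0.
  rewrite -ler_pdivrMr// -lee_fin; apply: le_trans H.
  by apply: ereal_sup_ubound; exists y => //=; rewrite xy0.
apply: ge_ereal_sup => _ [y /= /andP[xy0 xyr] <-].
by rewrite lee_fin ler_pdivrMr//; exact: H.
Qed.

Let sl_ge0 f x r : 0 < r -> (0 <= sl f x r)%E.
Proof.
move=> r0; apply: (@le_trans _ _ (`|f x - f (x + r)| / `|x - (x + r)|)%:E).
  by rewrite lee_fin divr_ge0.
by apply: ereal_sup_ubound; exists (x + r) => //=; exact: slope_set_neq0.
Qed.

(** The supremum runs over a set that grows with [r], so the limit is an infimum; afterwards the
    slope is handled through bounds at one radius. *)
Let lim_sl f x : lim (sl f x r @[r --> (0:R)^'+]) =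
  ereal_inf [set sl f x r | r in `]0, +oo[].
Proof.
apply: cvg_lim => //; apply: (@nondecreasing_at_right_cvge _ _ _ +oo%O) => //.
move=> r t _ _ rt; apply: le_ereal_sup => _ [y /= /andP[y0 yr] <-].
by exists y => //=; rewrite y0 (le_trans yr).
Qed.

Lemma abs_slopeE f x : locally_lipschitz f ->
  (abs_slope f x)%:E = ereal_inf [set sl f x r | r in `]0, +oo[].
Proof.
move=> lf; rewrite /abs_slope lim_sl fineK//.
have /locally_lipschitzP/(_ x)[k [d [k0 d0 Hk]]] := lf.
rewrite ge0_fin_numE.
  apply: (@le_lt_trans _ _ k%:E); last by rewrite ltry.
  apply: (@le_trans _ _ (sl f x (d / 2))).
    apply: ereal_inf_lbound; exists (d / 2) => //=.
    by rewrite in_itv/= andbT divr_gt0.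
  apply/slP; first by rewrite divr_gt0.
  move=> y xy; apply: Hk; rewrite ?subrr ?normr0//; apply: le_lt_trans xy _; lra.
apply/ereal_infP => z [r /=]; rewrite in_itv/= andbT => r0 <-.
exact: sl_ge0.
Qed.

Lemma abs_slope_ge0 f x : locally_lipschitz f -> 0 <= abs_slope f x.
Proof.
move=> lf; rewrite -lee_fin abs_slopeE//.
apply/ereal_infP => z [r /=]; rewrite in_itv/= andbT => r0 <-.
exact: sl_ge0.
Qed.

Lemma abs_slope_lt f x k : locally_lipschitz f -> abs_slope f x < k <->
  exists2 d, 0 < d & exists2 k', k' < k &
  forall y, `|x - y| <= d -> `|f x - f y| <= k' * `|x - y|.
Proof.
move=> lf; rewrite -lte_fin abs_slopeE//; split.
  move=> /ereal_inf_lt[z [r /= ]]; rewrite in_itv/= andbT => r0 <- srk.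
  exists r => //.
  have srf : sl f x r \is a fin_num.
    by rewrite ge0_fin_numE ?sl_ge0// (lt_trans srk)// ltry.
  exists (fine (sl f x r)); first by rewrite -lte_fin fineK.
  by apply/slP => //; rewrite fineK.
move=> [d d0 [k' k'k Hd]].
apply: (@le_lt_trans _ _ k'%:E); last by rewrite lte_fin.
apply: (@le_trans _ _ (sl f x d)); last exact/slP.
by apply: ereal_inf_lbound; exists d => //=; rewrite in_itv/= andbT.
Qed.

Lemma abs_slope_le f x k d : locally_lipschitz f -> 0 < d ->
  (forall y, `|x - y| < d -> `|f x - f y| <= k * `|x - y|) -> abs_slope f x <= k.
Proof.
move=> lf d0 H; rewrite leNgt; apply/negP => kf.
(* If the slope exceeded [k], then [k] itself could serve as [k'] for the bound [abs_slope f x]. *)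
suff : abs_slope f x < abs_slope f x by rewrite ltxx.
apply/(abs_slope_lt _ _ lf).
exists (d / 2); first by rewrite divr_gt0.
by exists k => // y xy; apply: H; lra.
Qed.

Lemma abs_slope_mono f g x d : locally_lipschitz f -> locally_lipschitz g ->
  0 < d -> (forall y, `|x - y| < d -> `|g x - g y| <= `|f x - f y|) ->
  abs_slope g x <= abs_slope f x.
Proof.
move=> lf lg d0 H; rewrite leNgt; apply/negP => fg.
have [r r0 [k kf Hk]] := (abs_slope_lt x _ lf).1 fg.
have : abs_slope g x <= k; last by rewrite leNgt kf.
apply: (abs_slope_le (d := Num.min r d)); rewrite ?lt_min ?r0//.
move=> y; rewrite lt_min => /andP[xr xd]; apply: le_trans (H _ xd) _; exact/Hk/ltW.
Qed.

(** A strict sublevel set of the slope is a countable union of closed sets: 1/(i+1) is used both as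
    the radius and as the gap below [k], and for a fixed increment [h] the condition is closed
    because f is continuous. *)
Lemma measurable_abs_slope f : locally_lipschitz f ->
  measurable_fun setT (abs_slope f).
Proof.
move=> lf; have cf := locally_lipschitz_continuous lf.
apply: (measurability (@RGenInftyO.G R)) => [|/= _ [_] [k] -> <-].
  exact: RGenInftyO.measurableE.
rewrite setTI.
pose F i := \bigcap_(h in [set h | `|h| <= i.+1%:R^-1])
   [set x | `|f x - f (x + h)| <= (k - i.+1%:R^-1) * `|h|].
suff -> : abs_slope f @^-1` `]-oo, k[%classic = \bigcup_i F i.
  apply: bigcupT_measurable => i; apply: closed_measurable.
  apply: closed_bigI => h _.
  rewrite -[X in closed X]/((fun x => `|f x - f (x + h)|) @^-1` [set y | y <= (k - i.+1%:R^-1) * `|h|]).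
  apply: preimage_closed; last exact: closed_le.
  move=> x _; apply: cvg_norm; apply: cvgB; first exact: cf.
  apply: (@continuous_comp _ _ _ (fun t => t + h) f); last exact: cf.
  by apply: cvgD; [exact: cvg_id|exact: cvg_cst].
apply/seteqP; split => x /=; rewrite ?in_itv/=.
  move=> /(abs_slope_lt _ _ lf)[d d0 [k' k'k Hk]].
  have kk' : 0 < k - k' by rewrite subr_gt0.
  near \oo => i.
  have i0 : 0 < i.+1%:R^-1 :> R by rewrite invr_gt0.
  have id : i.+1%:R^-1 < d by near: i; exact: (near_infty_natSinv_lt (PosNum d0)).
  have ik : i.+1%:R^-1 < k - k'.
    by near: i; exact: (near_infty_natSinv_lt (PosNum kk')).
  exists i => // h /= hi.
  have xh : `|x - (x + h)| = `|h| by rewrite opprD addrA subrr sub0r normrN.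
  apply: (le_trans (Hk (x + h) _)); first by rewrite xh (le_trans hi)// ltW.
  by rewrite xh ler_wpM2r// lerBrDr addrC -lerBrDr ltW.
move=> [i _ Hi]; apply/(abs_slope_lt _ _ lf).
exists i.+1%:R^-1; first by rewrite invr_gt0.
exists (k - i.+1%:R^-1); first by rewrite gtrBl invr_gt0.
move=> y xy; have := Hi (y - x); rewrite /= (_ : x + (y - x) = y); last by rewrite addrC subrK.
by rewrite (distrC y); exact.
Unshelve. all: by end_near. Qed.

End real_line.

(** * Increments of a function and the integral of its slope *)

Section lebesgue_points.
Context {R : realType}.
Implicit Types (f s : R -> R) (a b c x y r k d e : R).
Local Notation leb := (@lebesgue_measure R).

Lemma ge0_integral_itvU (F : R -> \bar R) a b c : measurable_fun setT F ->
  (forall x, 0 <= F x)%E -> a <= b -> b <= c ->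
  (\int[leb]_(x in `]a, c]) F x =
   \int[leb]_(x in `]a, b]) F x + \int[leb]_(x in `]b, c]) F x)%E.
Proof.
move=> mF F0 ab bc.
have -> : `]a, c]%classic = `]a, b]%classic `|` `]b, c]%classic.
  by rewrite -itv_bndbnd_setU// bnd_simp.
rewrite ge0_integral_setU//; first exact: measurable_funTS.
apply/disj_setPS => x [] /=; rewrite !in_itv/= => /andP[_ xb] /andP[bx _].
by move: (lt_le_trans bx xb); rewrite ltxx.
Qed.

Lemma lebesgue_pt_integral_le s x e : measurable_fun setT s -> (forall x, 0 <= s x) ->
  lebesgue_pt s x -> 0 < e -> exists2 d, 0 < d & forall p q, p <= x -> x <= q ->
    q - p < d -> ((s x * (q - p))%:E <=
      \int[leb]_(t in `]p, q]) (s t)%:E + (e * (q - p))%:E)%E.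
Proof.
move=> ms s0 sx e0.
have /fine_cvgP[] := sx.
move=> [d1 /= d10 H1] /cvgrPdist_le/(_ (e / 4)) [|d2 /= d20 H2].
  by rewrite divr_gt0.
pose d := Num.min d1 d2 / 2.
have d0 : 0 < d by rewrite divr_gt0// lt_min d10.
exists d => // p q px xq qpd.
have [->|pq] := eqVneq p q.
  by rewrite subrr !mulr0 adde0 integral_ge0// => t _; rewrite lee_fin.
have pq0 : 0 < q - p.
  by rewrite subr_gt0 lt_neqAle pq/= (le_trans px).
(* The interval contains [x] but need not be centred there; the ball of radius 2 (q - p) contains it
   and has length 4 (q - p), which the tolerance [e / 4] compensates. *)
pose r := 2 * (q - p).
have r0 : 0 < r by rewrite mulr_gt0.
have [rd1 rd2] : r < d1 /\ r < d2.
  by move: qpd; rewrite /d /r ltr_pdivlMr// mulrC lt_min => /andP[].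
have d1r : (davg s x r \is a fin_num) by apply: H1; rewrite /= ?sub0r ?normrN ?gtr0_norm.
have d2r : fine (davg s x r) <= e / 4.
  have := H2 r; rewrite /= !sub0r !normrN (gtr0_norm r0) => /(_ rd2 r0).
  by apply: le_trans; exact: ler_norm.
have mball : (leb (ball x r))^-1%E = ((r *+ 2)^-1)%:E.
  rewrite lebesgue_measure_ball ?(ltW r0)// inver ifF//.
  by apply/negbTE; rewrite mulrn_eq0/= gt_eqF.
have mabs : measurable_fun setT (fun t => `|s t - s x|%:E).
  apply/measurable_EFinP/measurableT_comp => //; exact: measurable_funB.
have intb : (\int[leb]_(t in ball x r) `|s t - s x|%:E <= (e * (q - p))%:E)%E.
  have : (davg s x r <= (e / 4)%:E)%E by rewrite -(fineK d1r) lee_fin.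
  rewrite /davg /iavg mball -lee_pdivlMl ?invr_gt0 ?mulrn_wgt0//.
  move=> /le_trans; apply; rewrite -EFinM lee_fin invrK /r; lra.
apply: (@le_trans _ _ (\int[leb]_(t in `]p, q]) ((s t)%:E + `|s t - s x|%:E))%E).
  have -> : (s x * (q - p))%:E = (\int[leb]_(t in `]p, q]) (cst (s x)%:E t))%E.
    by rewrite integral_cst//= lebesgue_measure_itv/= lte_fin -subr_gt0 pq0 -EFinB.
  apply: ge0_le_integral => //.
  - by move=> t _; rewrite lee_fin.
  - apply: emeasurable_funD; apply: measurable_funTS => //; exact/measurable_EFinP.
  - move=> t _; rewrite -EFinD lee_fin /=.
    by rewrite -lerBlDl distrC; exact: ler_norm.
rewrite ge0_integralD//.
- rewrite leeD2l//; apply: le_trans intb; apply: ge0_subset_integral => //.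
  + exact: measurable_ball.
  + exact: measurable_funTS.
  + move=> t /=; rewrite in_itv/= => /andP[pt tq].
    rewrite /ball/= /r ltr_norml; lra.
- by move=> t _; rewrite lee_fin.
- by apply: measurable_funTS; exact/measurable_EFinP.
- exact: measurable_funTS.
Qed.

End lebesgue_points.

Section slope_integral.
Context {R : realType}.
Implicit Types (f s : R -> R) (a b c x y r k d e : R).
Local Notation leb := (@lebesgue_measure R).

(* Locally f is k-Lipschitz.  There, Lebesgue's differentiation theorem gives
   the inequality up to e near almost every point; the remaining points are
   covered by an open set of measure at most e, on which the integrand is
   raised by k. *)
Lemma slope_integral_near f x k d e : locally_lipschitz f -> 0 <= k -> 0 < d ->
  (forall y z, `|x - y| < d -> `|x - z| < d -> `|f y - f z| <= k * `|y - z|) ->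
  0 < e -> forall u v, x - d < u -> u <= v -> v < x + d ->
  (`|f v - f u|%:E <=
    \int[leb]_(t in `]u, v]) (abs_slope f t)%:E + (k * e + e * (v - u))%:E)%E.
Proof.
move=> lf k0 d0 Hk e0.
set s := abs_slope f.
have s0 t : 0 <= s t by exact: abs_slope_ge0.
have ms : measurable_fun setT s by exact: measurable_abs_slope.
pose B : set R := ball x d.
have mB : measurable B by exact: measurable_ball.
have oB : open B by exact: ball_open.
(* On the ball the slope is at most [k], so its restriction is locally integrable and Lebesgue
   differentiation applies. *)
pose s' := s \_ B.
have s'0 t : 0 <= s' t by rewrite /s' patchE; case: ifP.
have ms' : measurable_fun setT s'.
  apply/(measurable_restrictT s mB). exact: measurable_funTS.
have s's t : B t -> s' t = s t by move=> Bt; rewrite /s' patchE mem_set.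
have s'les t : s' t <= s t by rewrite /s' patchE; case: ifP.
have sk t : B t -> s t <= k.
  move=> Bt.
  have [r /= r0 rB] : nbhs_ball t B by apply/nbhs_ballP; exact: open_nbhs_nbhs.
  apply: (abs_slope_le lf r0) => y ty; apply: Hk => //; exact: rB.
have ls' : locally_integrable setT s'.
  apply: integrable_locally_restrict => //.
  apply: measurable_bounded_integrable => //.
  - by rewrite /B /= lebesgue_measure_ball ?ltry// ltW.
  - exact: measurable_funTS.
  - exists k; split; first exact: num_real.
    by move=> z kz t Bt /=; rewrite ger0_norm// (le_trans (sk _ Bt))// ltW.
have [N [mN N0 HN]] := lebesgue_differentiation ls'.
have [U [oU NU Ue]] : exists U : set R, [/\ open U, N `<=` U & (leb U < e%:E)%E].
  have [|U [oU NU Ue]] := lebesgue_regularity_outer mN _ e0.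
    by rewrite (le_lt_trans _ (ltry 0))// le_eqVlt; apply/orP; left; apply/eqP.
  exists U; split => //.
  rewrite -(setDUK NU); apply: le_lt_trans (measureU2 _ _ _) _ => //.
    by apply: measurableD => //; exact: open_measurable.
  by move: (Ue); rewrite [X in (X + _ < _)%E](N0 : leb N = 0%E) add0e.
have mU := open_measurable oU.
pose w t := ((s t)%:E + (k * \1_U t)%:E)%E.
have w0 t : (0 <= w t)%E by rewrite adde_ge0// lee_fin// mulr_ge0.
have mU1 : measurable_fun setT (fun t : R => (k * \1_U t)%:E).
  by apply/measurable_EFinP; apply: measurable_funM => //; exact: measurable_indic.
have ms1 : measurable_fun setT (fun t : R => (s t)%:E) by exact/measurable_EFinP.
have mw : measurable_fun setT w by exact: emeasurable_funD.
(* Confinement to the ball is a premise inside [P], so that [cousin] can run over the whole line;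
   around a point outside the ball [P] holds vacuously. *)
pose P u v := x - d < u -> v < x + d -> u <= v ->
  (`|f v - f u|%:E <= \int[leb]_(t in `]u, v]) w t + (e * (v - u))%:E)%E.
have HP u v : u <= v -> P u v.
  apply: cousin => {u v} [a b c ab bc Pab Pbc xa cx ac|y].
    have : (`|f c - f a|%:E <= `|f b - f a|%:E + `|f c - f b|%:E)%E.
      rewrite -EFinD lee_fin (_ : f c - f a = f b - f a + (f c - f b)).
        exact: ler_normD.
      by ring.
    move=> /le_trans; apply.
    apply: (le_trans (leeD (Pab xa (le_lt_trans bc cx) ab) (Pbc (lt_le_trans xa ab) cx bc))).
    rewrite addeACA -ge0_integral_itvU// -EFinD -mulrDr leeD2l// lee_fin.
    by rewrite le_eqVlt; apply/orP; left; apply/eqP; ring.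
  have [By|nBy] := pselect (B y); last first.
    exists 1 => // u v _ uy yv _ xu vx; exfalso; apply: nBy.
    rewrite /B /ball/= ltr_norml; lra.
  have [Uy|nUy] := pselect (U y).
    have [r /= r0 rU] : nbhs_ball y U by apply/nbhs_ballP; exact: open_nbhs_nbhs.
    exists r => // u v yu uy yv vy xu vx uv.
    have : `|f v - f u| <= k * (v - u).
      rewrite -(@ger0_norm _ (v - u)) ?subr_ge0//; apply: Hk; rewrite ltr_norml; lra.
    rewrite -lee_fin => /le_trans; apply.
    apply: (@le_trans _ _ (\int[leb]_(t in `]u, v]) w t)%E); last first.
      by rewrite leeDl// lee_fin mulr_ge0// ?(ltW e0)// subr_ge0.
    have -> : (k * (v - u))%:E = (\int[leb]_(t in `]u, v]) (cst k%:E t))%E.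
      rewrite integral_cst//= lebesgue_measure_itv/= lte_fin.
      have [->|uv'] := eqVneq u v; first by rewrite ltxx subrr mulr0 mule0.
      by rewrite lt_neqAle uv' uv -EFinB.
    apply: ge0_le_integral => //; first exact: measurable_funTS.
    move=> t /=; rewrite in_itv/= => /andP[ut tv].
    rewrite /w indicE mem_set ?mulr1; first by rewrite leeDr// lee_fin.
    by apply: rU; rewrite /ball/= ltr_norml; lra.
  (* One half is lost between f and its slope at [y], the other between that slope and its average
     near [y]. *)
  have e20 : 0 < e / 2 by rewrite divr_gt0.
  have ly : lebesgue_pt s' y.
    by apply: contrapT => nly; apply: nUy; apply: NU; exact: HN.
  have [d1 d10 Hd1] := lebesgue_pt_integral_le ms' s'0 ly e20.
  have [d2 d20 [k' k's Hd2]] : exists2 d, 0 < d & exists2 k' : R, k' < s y + e / 2 &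
      forall z, `|y - z| <= d -> `|f y - f z| <= k' * `|y - z|.
    by apply/abs_slope_lt => //; rewrite ltrDl.
  exists (Num.min d1 d2 / 2); first by rewrite divr_gt0// lt_min d10.
  move=> u v yu uy yv vy xu vx uv.
  have [hd1 hd2] : v - u < d1 /\ v - u < d2.
    by apply/andP; rewrite -lt_min; lra.
  have fvu : `|f v - f u| <= (s y + e / 2) * (v - u).
    rewrite (_ : f v - f u = - (f y - f v) + (f y - f u)); last ring.
    apply: le_trans (ler_normD _ _) _; rewrite normrN.
    have H1 : `|f y - f v| <= (s y + e / 2) * (v - y).
      rewrite -(@ger0_norm _ (v - y)) ?subr_ge0// [in leRHS]distrC.
      apply: (le_trans (Hd2 v _)); first by rewrite ler_norml; lra.
      by rewrite ler_wpM2r// ltW.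
    have H2 : `|f y - f u| <= (s y + e / 2) * (y - u).
      rewrite -(@ger0_norm _ (y - u)) ?subr_ge0//.
      apply: (le_trans (Hd2 u _)); first by rewrite ler_norml; lra.
      by rewrite ler_wpM2r// ltW.
    apply: (le_trans (lerD H1 H2)); rewrite -mulrDr le_eqVlt.
    by apply/orP; left; apply/eqP; ring.
  have := Hd1 u v uy yv hd1; rewrite (s's _ By) => Hi.
  apply: (@le_trans _ _ ((s y * (v - u))%:E + (e / 2 * (v - u))%:E)%E).
    by rewrite -EFinD lee_fin -mulrDl.
  apply: (le_trans (leeD2r _ Hi)); rewrite -addeA -EFinD.
  apply: leeD; last by rewrite lee_fin -mulrDl -splitr.
  apply: ge0_le_integral => //.
  - by move=> t _; rewrite lee_fin.
  - by apply: measurable_funTS; exact/measurable_EFinP.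
  - exact: measurable_funTS.
  - move=> t _; apply: (@le_trans _ _ (s t)%:E); first by rewrite lee_fin.
    by rewrite /w leeDl// lee_fin mulr_ge0.
move=> u v xu uv vx.
apply: (le_trans (HP u v uv xu vx uv)).
rewrite /w ge0_integralD//; last 4 first.
- by move=> t _; rewrite lee_fin.
- exact: measurable_funTS.
- by move=> t _; rewrite lee_fin mulr_ge0.
- exact: measurable_funTS.
rewrite -addeA EFinD leeD2l// leeD2r//.
under eq_integral do rewrite EFinM.
rewrite ge0_integralZl//; last by apply: measurable_funTS; exact/measurable_EFinP/measurable_indic.
rewrite EFinM lee_wpmul2l// integral_indic//= (le_trans _ (ltW Ue))//.
by apply: le_measure; rewrite ?inE//; exact: measurableI.
Qed.

Lemma slope_integral f a b : locally_lipschitz f -> a <= b ->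
  (`|f b - f a|%:E <= \int[leb]_(t in `]a, b[) (abs_slope f t)%:E)%E.
Proof.
move=> lf ab.
have ms1 : measurable_fun setT (fun t : R => (abs_slope f t)%:E).
  by apply/measurable_EFinP; exact: measurable_abs_slope.
have s0 t : (0 <= (abs_slope f t)%:E)%E by rewrite lee_fin abs_slope_ge0.
(* Half-open intervals concatenate without overlap, as the transitivity premise of [cousin]
   requires. *)
rewrite integral_itv_bndo_bndc; last exact: measurable_funTS.
move: a b ab; apply: cousin => [a b c ab bc Pab Pbc|x].
  have : (`|f c - f a|%:E <= `|f b - f a|%:E + `|f c - f b|%:E)%E.
    rewrite -EFinD lee_fin (_ : f c - f a = f b - f a + (f c - f b)).
      exact: ler_normD.
    by ring.
  move=> /le_trans; apply.
  by apply: (le_trans (leeD Pab Pbc)); rewrite -ge0_integral_itvU.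
have /locally_lipschitzP/(_ x)[k [d [k0 d0 Hk]]] := lf.
exists d => // u v xu ux xv vx.
apply/lee_addgt0Pr => e e0.
have uv : 0 <= v - u by rewrite subr_ge0 (le_trans ux).
have D0 : 0 < k + (v - u) + 1 by rewrite ltr_wpDl// addr_ge0.
apply: le_trans (slope_integral_near lf k0 d0 Hk (divr_gt0 e0 D0) xu (le_trans ux xv) vx) _.
rewrite leeD2l// lee_fin.
rewrite [X in X + _]mulrC -mulrDr -mulrA ler_piMr ?(ltW e0)//.
by rewrite mulrC ler_pdivrMr// mul1r lerDl.
Qed.

End slope_integral.

(** * Young functions *)

Section young_functions.
Context {R : realType} (Phi : R -> R).
Hypothesis nPhi : nice_young Phi.

Lemma young_conv t x y : 0 <= t <= 1 ->
  Phi (t * x + (1 - t) * y) <= t * Phi x + (1 - t) * Phi y.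
Proof.
move=> t01.
have /andP[t0 t1] := t01.
have := @young_convex _ _ nPhi (Itv01 t0 t1) x y.
by rewrite !in_setT => /(_ isT isT).
Qed.

Lemma young_gt0 x : x != 0 -> 0 < Phi x.
Proof.
move=> x0; rewrite lt_neqAle (young_ge0 nPhi) andbT eq_sym.
by apply: contra x0 => /eqP/(young_eq0 nPhi)/eqP.
Qed.

Lemma young_abs x : Phi `|x| = Phi x.
Proof.
by case: ger0P => // _; rewrite (young_even nPhi).
Qed.

Lemma young_nondecreasing x y : 0 <= x -> x <= y -> Phi x <= Phi y.
Proof.
move=> x0; rewrite le_eqVlt => /predU1P[->//|xy].
have y0 : 0 < y by exact: le_lt_trans xy.
have xy01 : 0 <= x / y <= 1 by rewrite divr_ge0 ?(ltW y0)// ler_pdivrMr// mul1r ltW.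
have := young_conv y 0 xy01.
rewrite mulr0 addr0 (young_at0 nPhi) mulr0 addr0 divfK ?gt_eqF// => /le_trans; apply.
by rewrite ler_piMl ?young_ge0//; case/andP: xy01.
Qed.

Lemma measurable_young : measurable_fun setT Phi.
Proof.
have -> : Phi = (fun x => Phi (Num.max x 0)) \o Num.norm.
  by apply/funext => x /=; rewrite max_l// young_abs.
apply: measurableT_comp => //; apply: nondecreasing_measurable => // x y xy.
apply: young_nondecreasing; first by rewrite le_max lexx orbT.
by rewrite ge_max !le_max xy lexx orbT.
Qed.

(** By convexity the difference quotients at [y] are nondecreasing in the increment, so the right
    derivative is their infimum. *)
Lemma right_derive_le y h : 0 <= y -> y < h ->
  right_derive Phi y * (h - y) <= Phi h - Phi y.
Proof.
move=> y0 yh; have hy0 : 0 < h - y by rewrite subr_gt0.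
pose q k := k^-1 * (Phi (y + k) - Phi y).
have q_nd : {in `]0, +oo[ &, nondecreasing_fun q}.
  move=> a b; rewrite !in_itv/= !andbT => a0 b0 ab.
  have ab01 : 0 <= a / b <= 1 by rewrite divr_ge0 ?(ltW a0) ?(ltW b0)// ler_pdivrMr// mul1r.
  have := young_conv (y + b) y ab01.
  rewrite (_ : a / b * _ + _ = y + a); last by field; rewrite gt_eqF.
  move=> H; rewrite /q [leLHS]mulrC ler_pdivrMr//.
  rewrite (_ : b^-1 * _ * a = a / b * (Phi (y + b) - Phi y)); last by ring.
  by move: H; rewrite mulrBr mulrBl mul1r; lra.
have q0 : has_lbound (q @` `]0, +oo[).
  exists 0 => z [k /=]; rewrite in_itv/= andbT => k0 <-.
  rewrite mulr_ge0 ?invr_ge0 ?(ltW k0)// subr_ge0 young_nondecreasing//.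
  by rewrite lerDl ltW.
have q_lim : right_derive Phi y = inf (q @` `]0, +oo[).
  by apply: cvg_lim => //; apply: (nondecreasing_at_right_cvgr (b := +oo%O)).
have : right_derive Phi y <= q (h - y).
  by rewrite q_lim; apply: inf_lbound => //; exists (h - y); rewrite //= in_itv/= hy0.
by rewrite /q (_ : y + (h - y) = h); [rewrite ler_pdivlMl// mulrC|ring].
Qed.

(* Young's inequality [h u <= y u + (Phi h - Phi y)], for [u] a slope of [Phi] at
   [y], with the term [Phi y] dropped. *)
Lemma le_right_derive_inv h u : 0 < u ->
  (h%:E <= right_derive_inv Phi u%:E + (Phi h / u)%:E)%E.
Proof.
move=> u0; rewrite -leeBlDr// -EFinB; apply/ereal_infP => _ [y [y0 uy] <-].
rewrite lee_fin in uy; rewrite lee_fin lerBlDr.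
have [hy|yh] := leP h y; first by rewrite ler_wpDr// divr_ge0 ?(young_ge0 nPhi)// ltW.
rewrite -lerBlDl ler_pdivlMr//.
have yh' : 0 <= h - y by rewrite subr_ge0 ltW.
rewrite mulrC (le_trans (ler_wpM2r yh' uy))// (le_trans (right_derive_le y0 yh))//.
by rewrite gerBl (young_ge0 nPhi).
Qed.

Lemma right_derive_inv_ge0 u : (0 <= right_derive_inv Phi u)%E.
Proof. by apply/ereal_infP => _ [y [y0 _] <-]; rewrite lee_fin. Qed.

Lemma right_derive_inv_y : (right_derive_inv Phi +oo = +oo)%E.
Proof.
rewrite /right_derive_inv (_ : [set y%:E | y in _] = set0) ?ereal_inf0//.
by rewrite -subset0 => z [y [_ yoo] _]; move: yoo; rewrite leye_eq.
Qed.

Hypothesis Phi2 : {in `]0, +oo[ &, {homo (fun x => Phi x / x ^+ 2) : x y / x <= y}}.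

(** This is the monotonicity of Phi(x)/x^2, multiplied by h^2. Inside a strip below level [b] it
    replaces the constant [b] by the actual value of the function. *)
Lemma young_sqr_mono h b g : 0 <= h -> 0 < g -> g <= b ->
  Phi (h / b) * b ^+ 2 <= Phi (h / g) * g ^+ 2.
Proof.
move=> h0 g0 gb; have b0 := lt_le_trans g0 gb.
have [->|hn0] := eqVneq h 0; first by rewrite !mul0r (young_at0 nPhi) !mul0r.
have hgt0 : 0 < h by rewrite lt_neqAle eq_sym hn0.
have := @Phi2 (h / b) (h / g).
rewrite !in_itv/= !andbT => /(_ (divr_gt0 hgt0 b0) (divr_gt0 hgt0 g0)).
rewrite ler_pM2l// lef_pV2 ?posrE// => /(_ gb).
rewrite !expr_div_n !invf_div !mulrA ler_pM2r// invr_gt0 exprn_gt0//.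
Qed.

Lemma young_mod_ge z : Phi z <= Phi 1 * young_mod Phi z.
Proof.
rewrite /young_mod -[Phi z]young_abs; case: ifPn => z1; last first.
  by rewrite mulrC divfK// gt_eqF// young_gt0.
have [->|z0] := eqVneq z 0; first by rewrite normr0 (young_at0 nPhi) expr0n mulr0.
have z0' : 0 < `|z| by rewrite normr_gt0.
have := @Phi2 `|z| 1; rewrite !in_itv/= !andbT => /(_ z0' ltr01 z1).
by rewrite expr1n divr1 ler_pdivrMr ?exprn_gt0// real_normK// num_real.
Qed.

(** Beyond 1 the ratio Phi(x)/x^2 is at least Phi(1). This is how the quadratic energy in Poincare's
    inequality is dominated by the Young energy. *)
Lemma sqr_le_young_mod z : z ^+ 2 <= young_mod Phi z.
Proof.
rewrite /young_mod; case: ifPn => //; rewrite -ltNge => z1.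
have z0 : 0 < `|z| := lt_trans ltr01 z1.
have := @Phi2 1 `|z|; rewrite !in_itv/= !andbT => /(_ ltr01 z0 (ltW z1)).
rewrite expr1n divr1 ler_pdivlMr ?exprn_gt0// real_normK ?num_real// => H.
by rewrite ler_pdivlMr ?young_gt0 ?oner_eq0// mulrC.
Qed.

Lemma young_mod_ge0 z : 0 <= young_mod Phi z.
Proof. exact: le_trans (sqr_ge0 z) (sqr_le_young_mod z). Qed.

Lemma measurable_young_mod : measurable_fun setT (young_mod Phi).
Proof.
apply: measurable_fun_ifT => //=.
- exact: measurable_fun_ler.
- by apply: measurable_funM => //; apply: measurableT_comp => //; exact: measurable_young.
Qed.

End young_functions.

(** * Energy of a crossing *)

Section measurability.
Context d (T : measurableType d) {R : realType}.

Lemma measurable_invr : measurable_fun setT (@GRing.inv R).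
Proof.
have -> : [set: R] = ~` [set 0] `|` [set 0] by rewrite setUC setUv.
apply/measurable_funU => //; first exact: measurableC.
split; last exact: measurable_fun_set1.
apply: open_continuous_measurable_fun; first by apply: closed_openC; exact: (@closed_eq R 0).
by move=> x /set_mem/= x0; apply: inv_continuous; apply/eqP.
Qed.

Lemma measurable_fun_div (D : set T) (f g : T -> R) :
  measurable_fun D f -> measurable_fun D g -> measurable_fun D (fun x => f x / g x).
Proof.
move=> mf mg; apply: measurable_funM => //.
exact: (measurableT_comp measurable_invr).
Qed.

(* Unlike [ge0_le_integral], no measurability is required. *)
Lemma ge0_integral_mono (mu : {measure set T -> \bar R}) (f g : T -> \bar R) :
  (forall x, 0 <= f x)%E -> (forall x, f x <= g x)%E ->
  (\int[mu]_x f x <= \int[mu]_x g x)%E.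
Proof.
move=> f0 fg; rewrite !ge0_integralTE//; last by move=> x; exact: le_trans (fg x).
by apply: le_ereal_sup => _ [h /= hf <-]; exists h => //= x; exact: le_trans (fg x).
Qed.

End measurability.

Section crossing.
Context {R : realType}.
Implicit Types (g : R -> R) (a b u v : R).

Lemma sup_closed_mem (A : set R) : closed A -> A !=set0 -> has_ubound A -> A (sup A).
Proof. by move=> cA A0 uA; rewrite [A in A _](closure_id _).1//; exact: closure_sup. Qed.

Lemma inf_closed_mem (A : set R) : closed A -> A !=set0 -> has_lbound A -> A (inf A).
Proof.
move=> cA A0 lA.
have cNA : closed (-%R @^-1` A).
  by apply: preimage_closed => // x _; exact: opp_continuous.
have : (-%R @^-1` A) (sup (-%R @^-1` A)).
  apply: sup_closed_mem => //.
    by case: A0 => x Ax; exists (- x); rewrite /= opprK.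
  by case: lA => l Al; exists (- l) => x /= /Al; rewrite lerNr.
rewrite /= /inf (_ : -%R @^-1` A = [set - x | x in A])//.
apply/seteqP; split => [x Ax|_ [x Ax <-]] /=; last by rewrite opprK.
by exists (- x) => //; rewrite opprK.
Qed.

(** [v'] is the first point where [g] reaches [b], and [u'] the last point before [v'] where [g] is
    at most [a]; in between, [g] stays strictly inside the strip. *)
Lemma crossing_up g a b u v : continuous g -> a < b -> u <= v ->
  g u <= a -> b <= g v -> exists u' v', [/\ u <= u', u' < v', v' <= v,
    b - a <= g v' - g u' & forall t, u' < t < v' -> a < g t < b].
Proof.
move=> cg ab uv gua gvb.
pose V := `[u, v] `&` (g @^-1` [set y | b <= y]).
have cV : closed V.
  apply: closedI; first exact: interval_closed.
  by apply: preimage_closed; [move=> x _; exact: cg|exact: closed_ge].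
have V0 : V v by split; rewrite //= in_itv/= uv lexx.
have lV : has_lbound V by exists u => x [/=]; rewrite in_itv/= => /andP[].
have [/=] := inf_closed_mem cV (ex_intro _ _ V0) lV.
set v' := inf V; rewrite in_itv/= => /andP[uv' v'v] gv'.
pose U := `[u, v'] `&` (g @^-1` [set y | y <= a]).
have cU : closed U.
  apply: closedI; first exact: interval_closed.
  by apply: preimage_closed; [move=> x _; exact: cg|exact: closed_le].
have U0 : U u by split; rewrite //= in_itv/= uv' lexx.
have uU : has_ubound U by exists v' => x [/=]; rewrite in_itv/= => /andP[].
have [/=] := sup_closed_mem cU (ex_intro _ _ U0) uU.
set u' := sup U; rewrite in_itv/= => /andP[uu' u'v'] gu'.
exists u', v'; split => //.
- rewrite lt_neqAle u'v' andbT; apply/eqP => E.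
  by move: (lt_le_trans (le_lt_trans gu' ab) gv'); rewrite E ltxx.
- exact: lerB.
- move=> t /andP[u't tv']; apply/andP; split; rewrite ltNge; apply/negP => H.
    suff : t <= u' by rewrite leNgt u't.
    apply: sup_upper_bound; first by split => //; exists u.
    by split => //=; rewrite in_itv/= (ltW tv') (le_trans uu')// ltW.
  suff : v' <= t by rewrite leNgt tv'.
  apply: inf_lbound => //; split => //=; rewrite in_itv/=.
  by rewrite (le_trans uu') ?(ltW u't)//= (le_trans (ltW tv')).
Qed.

Lemma crossing g a b u v : continuous g -> a < b -> u <= v ->
  (g u <= a /\ b <= g v) \/ (b <= g u /\ g v <= a) ->
  exists u' v', [/\ u <= u', u' < v', v' <= v,
    b - a <= `|g v' - g u'| & forall t, u' < t < v' -> a < g t < b].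
Proof.
move=> cg ab uv [[gu gv]|[gu gv]].
  have [u' [v' [uu' uv' vv' H K]]] := crossing_up cg ab uv gu gv.
  by exists u', v'; split => //; exact: le_trans (ler_norm _).
have [|||||u' [v' [uu' uv' vv' H K]]] := @crossing_up (- g) (- b) (- a) u v.
- by move=> x; apply: continuousN; exact: cg.
- by rewrite ltrN2.
- exact: uv.
- by rewrite lerN2.
- by rewrite lerN2.
exists u', v'; split => //.
  rewrite distrC; apply: (le_trans _ (ler_norm _)); move: H.
  by rewrite -[(- g) v']/(- g v') -[(- g) u']/(- g u'); lra.
by move=> t /K; rewrite -[(- g) t]/(- g t) !ltrN2 andbC.
Qed.

End crossing.

Section interval_energy.
Context {R : realType} (Phi : R -> R).
Hypothesis nPhi : nice_young Phi.
Hypothesis Phi2 : {in `]0, +oo[ &, {homo (fun x => Phi x / x ^+ 2) : x y / x <= y}}.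
Variables g s n : R -> R.
Hypotheses (mg : measurable_fun setT g) (ms : measurable_fun setT s)
  (mn : measurable_fun setT n).
Hypotheses (s0 : forall x, 0 <= s x) (n0 : forall x, 0 <= n x).
Local Notation leb := (@lebesgue_measure R).

(** [s] is kept apart from the slope of [g]: the crossing argument only asks that its integral bound
    the increments of [g]. So the slope of f can be used for |f|, both divided by K. *)
Definition energy_density (t : R) : R := young_mod Phi (s t / g t) * g t ^+ 2 * n t.

Lemma energy_density_ge0 t : 0 <= energy_density t.
Proof. by rewrite mulr_ge0// mulr_ge0 ?sqr_ge0//; exact: (young_mod_ge0 nPhi Phi2). Qed.

Lemma measurable_energy_density : measurable_fun setT energy_density.
Proof.
apply: measurable_funM => //; apply: measurable_funM; last exact: measurable_funX.
apply: measurableT_comp; first exact: (measurable_young_mod nPhi).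
exact: measurable_fun_div.
Qed.

(* With y the left inverse of the right derivative at 1/(N n), Young's
   inequality bounds h by N n Phi(h) + y; the Orlicz norm says that y has
   integral at most 1/2, while h = s/b has integral at least 3/4. *)
Lemma interval_energy (A : set R) (b N u v : R) : 0 < b -> 0 < N ->
  (\int[leb]_t (2%:E * right_derive_inv Phi (`|indic_over A n t| * (N^-1)%:E)) <= 1)%E ->
  `]u, v[ `<=` A -> (forall t, u < t < v -> 0 < g t < b) ->
  ((3 / 4 * b)%:E <= \int[leb]_(t in `]u, v[) (s t)%:E)%E ->
  ((b ^+ 2 / 4)%:E <=
    (N * Phi 1)%:E * \int[leb]_(t in `]u, v[) (energy_density t)%:E)%E.
Proof.
move=> b0 N0 intY uvA gb ints.
set D : set R := `]u, v[%classic.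
have mD : measurable D by exact: measurable_itv.
pose h t := s t / b.
have h0 t : 0 <= h t by rewrite divr_ge0// ltW.
have mh : measurable_fun setT h by exact: measurable_funM.
pose F t := N * (n t * Phi (h t)).
have F0 t : 0 <= F t by rewrite mulr_ge0 ?(ltW N0)// mulr_ge0// (young_ge0 nPhi).
have mF : measurable_fun setT F.
  apply: measurable_funM => //; apply: measurable_funM => //.
  exact: (measurableT_comp (measurable_young nPhi)).
(* A real-valued measurable minorant of [Y]; [Y] itself, which may be infinite, then enters only
   through monotonicity of the integral. *)
pose k t := Num.max (h t - F t) 0.
have k0 t : 0 <= k t by rewrite le_max lexx orbT.
have mk : measurable_fun setT k.
  by apply: measurable_maxr => //; exact: measurable_funB.
pose Y t := right_derive_inv Phi (`|indic_over A n t| * (N^-1)%:E).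
have Y0 t : (0 <= Y t)%E by exact: right_derive_inv_ge0.
have kY t : D t -> ((k t)%:E <= Y t)%E.
  move=> Dt; have At : A t by exact: uvA.
  rewrite /Y /indic_over indicE mem_set// mul1e.
  have [nt0|nt0] := eqVneq (n t) 0.
    rewrite nt0 inve0 gt0_mulye ?lte_fin ?invr_gt0// right_derive_inv_y; exact: leey.
  have nt : 0 < n t by rewrite lt_neqAle eq_sym nt0 n0.
  have u0 : 0 < (n t)^-1 * N^-1 by rewrite mulr_gt0// invr_gt0.
  rewrite inver (negbTE nt0) /= ger0_norm ?invr_ge0// -EFinM.
  rewrite /k maxEge; case: ifPn => _; last exact: right_derive_inv_ge0.
  have := le_right_derive_inv nPhi (h t) u0.
  rewrite [in X in X -> _](_ : Phi (h t) / _ = F t); first by rewrite EFinB leeBlDr.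
  by rewrite /F -invfM invrK mulrCA mulrA mulrC; ring.
have intk : (\int[leb]_(t in D) (k t)%:E <= (1 / 2)%:E)%E.
  (* The factor 2 in the Orlicz function yields the bound 1/2, and 3/4 - 1/2 leaves 1/4 for [F]. *)
  have : (\int[leb]_(t in D) (2%:E * (k t)%:E) <= 1)%E.
    apply: le_trans intY; rewrite integral_mkcond; apply: ge0_integral_mono => t.
      by rewrite patchE; case: ifPn => // _; rewrite mule_ge0// lee_fin.
    rewrite patchE; case: ifPn => [/set_mem Dt|_]; last by rewrite mule_ge0//; exact: Y0.
    by rewrite lee_pmul2l//; exact: kY.
  rewrite ge0_integralZl//.
  - by rewrite -lee_pdivlMl// mul1r mule1.
  - by apply: measurable_funTS; exact/measurable_EFinP.
  - by move=> t _; rewrite lee_fin.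
have inth : ((3 / 4)%:E <= \int[leb]_(t in D) (h t)%:E)%E.
  have : ((3 / 4 * b)%:E <= b%:E * \int[leb]_(t in D) (h t)%:E)%E.
    rewrite -ge0_integralZl//.
    - apply: le_trans ints _; rewrite le_eqVlt; apply/orP; left; apply/eqP.
      by apply: eq_integral => t _; rewrite -EFinM /h mulrC divfK// gt_eqF.
    - by apply: measurable_funTS; exact/measurable_EFinP.
    - by move=> t _; rewrite lee_fin.
    - by rewrite lee_fin ltW.
  by rewrite mulrC EFinM lee_pmul2l// lte_fin.
have intF : ((1 / 4)%:E <= \int[leb]_(t in D) (F t)%:E)%E.
  have : (\int[leb]_(t in D) (h t)%:E <= (1 / 2)%:E + \int[leb]_(t in D) (F t)%:E)%E.
    apply: le_trans (leeD2r _ intk).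
    rewrite -ge0_integralD//.
    - apply: ge0_le_integral => //.
      + by move=> t _; rewrite lee_fin.
      + by apply: measurable_funTS; exact/measurable_EFinP.
      + by apply: emeasurable_funD; apply: measurable_funTS; exact/measurable_EFinP.
      + by move=> t _; rewrite -EFinD lee_fin -lerBlDr le_max lexx.
    - by move=> t _; rewrite lee_fin.
    - by apply: measurable_funTS; exact/measurable_EFinP.
    - by move=> t _; rewrite lee_fin.
    - by apply: measurable_funTS; exact/measurable_EFinP.
  move=> /(le_trans inth); rewrite -leeBlDl// -EFinB => /(le_trans _); apply.
  by rewrite lee_fin; lra.
have P10 : 0 <= Phi 1 := young_ge0 nPhi 1.
apply: (@le_trans _ _ ((b ^+ 2)%:E * \int[leb]_(t in D) (F t)%:E)%E).
  by rewrite EFinM; apply: lee_wpmul2l; rewrite ?lee_fin ?sqr_ge0// -div1r.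
rewrite -!ge0_integralZl//; last 6 first.
- by apply: measurable_funTS; apply/measurable_EFinP; exact: measurable_energy_density.
- by move=> t _; rewrite lee_fin energy_density_ge0.
- by rewrite lee_fin mulr_ge0// ltW.
- by apply: measurable_funTS; exact/measurable_EFinP.
- by move=> t _; rewrite lee_fin.
- by rewrite lee_fin sqr_ge0.
apply: ge0_le_integral => //.
- by move=> t _; rewrite lee_fin mulr_ge0// sqr_ge0.
- by apply: measurable_funTS; apply/measurable_EFinP; apply: measurable_funM.
- apply: measurable_funTS; apply/measurable_EFinP; apply: measurable_funM => //.
  exact: measurable_energy_density.
move=> t; rewrite /D /= in_itv/= => /gb/andP[gt0 gtb].
rewrite -!EFinM lee_fin /F /energy_density.
rewrite (_ : b ^+ 2 * _ = N * n t * (Phi (s t / b) * b ^+ 2)); last by rewrite /h; ring.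
rewrite (_ : N * Phi 1 * _ = N * n t * (Phi 1 * young_mod Phi (s t / g t) * g t ^+ 2)); last by ring.
rewrite ler_wpM2l ?mulr_ge0 ?(ltW N0)//.
apply: (le_trans (young_sqr_mono nPhi Phi2 (s0 t) gt0 (ltW gtb))).
by rewrite ler_wpM2r ?sqr_ge0// young_mod_ge.
Qed.

End interval_energy.

(** * One side of the median *)

Section xlog.
Context {R : realType}.
Implicit Types x y p q : R.

Lemma ln_leB1 x : 0 < x -> ln x <= x - 1.
Proof. by move=> x0; have := @le_ln1Dx R (x - 1); rewrite subrKC; apply; lra. Qed.

Lemma ln2_ge : 1 / 2 <= ln 2 :> R.
Proof.
have : ln (2^-1) <= 2^-1 - 1 :> R by apply: ln_leB1.
by rewrite lnV ?posrE//; lra.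
Qed.

Lemma ln4 : ln 4 = 2 * ln 2 :> R.
Proof.
by rewrite (_ : 4 = 2 ^+ 2 :> R) ?lnXn// ?mulr_natl//; rewrite expr2; lra.
Qed.

Lemma xlogV_ge0 p : 0 <= p -> p <= 1 -> 0 <= xlogV p.
Proof.
rewrite le_eqVlt => /predU1P[<-|p0 p1]; first by rewrite /xlogV mul0r.
by rewrite /xlogV mulr_ge0 ?(ltW p0)// ln_ge0// invf_ge1.
Qed.

(** Write ln (1/x) = ln (y/x) + ln (1/y). Then x ln (y/x) <= y - x, and this is paid for by ln (1/y)
    >= ln 4 >= 1. *)
Lemma xlogV_le_quarter x y : 0 < x -> x <= y -> y <= 4^-1 -> xlogV x <= xlogV y.
Proof.
move=> x0 xy y4; have y0 := lt_le_trans x0 xy.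
have ly : 1 <= ln y^-1.
  apply: (@le_trans _ _ (ln 4)); first by rewrite ln4; have := ln2_ge; lra.
  by rewrite ler_ln ?posrE ?invr_gt0// -[leLHS]invrK lef_pV2 ?posrE ?invr_gt0.
have lxy : ln x^-1 = ln (y / x) + ln y^-1.
  by rewrite -lnM ?posrE ?divr_gt0 ?invr_gt0// mulrAC divff ?mul1r// gt_eqF.
have : x * ln (y / x) <= y - x.
  have := ln_leB1 (divr_gt0 y0 x0).
  by rewrite -(ler_pM2l x0) mulrBr mulr1 mulrCA divff ?mulr1// gt_eqF.
rewrite /xlogV lxy mulrDr => H; rewrite -subr_ge0.
rewrite (_ : _ - _ = (y - x) * (ln y^-1 - 1) + ((y - x) - x * ln (y / x))); last by ring.
by rewrite addr_ge0 ?mulr_ge0 ?subr_ge0.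
Qed.

(** As ln 4 = 2 ln 2, the chord of ln over [2, 4] lies on a line through the origin; concavity at
    1/y gives ln (1/y) >= (1/y) (ln 2)/2. *)
Lemma xlogV_quarter_le y : 4^-1 <= y -> y <= 2^-1 -> xlogV 4^-1 <= xlogV y.
Proof.
move=> y4 y2; have y0 : 0 < y by apply: lt_le_trans y4; rewrite invr_gt0.
have z2 : 2 <= y^-1 by rewrite -[leLHS]invrK lef_pV2 ?posrE ?invr_gt0.
have z4 : y^-1 <= 4 by rewrite -[leRHS]invrK lef_pV2 ?posrE ?invr_gt0.
have t0 : 0 <= 2 - y^-1 / 2 by lra.
have t1 : 2 - y^-1 / 2 <= 1 by lra.
have := @concave_ln R (Itv01 t0 t1) 2 4; rewrite !ltr0n => /(_ isT isT).
have convE (a b : R^o) : conv (Itv01 t0 t1) a b =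
    (2 - y^-1 / 2) * a + (1 - (2 - y^-1 / 2)) * b by [].
rewrite !convE ln4.
rewrite (_ : _ * 2 + _ * 4 = y^-1); last by lra.
rewrite (_ : _ * ln 2 + _ = y^-1 / 2 * ln 2); last by ring.
move=> H; rewrite /xlogV invrK ln4 -ler_pdivrMl//.
by apply: le_trans H; rewrite le_eqVlt; apply/orP; left; apply/eqP; field; rewrite gt_eqF.
Qed.

Lemma xlogV_mono x y : 0 < x -> x <= 4^-1 -> x <= y -> y <= 2^-1 ->
  xlogV x <= xlogV y.
Proof.
move=> x0 x4 xy y2; have [y4|/ltW y4] := leP y 4^-1.
  exact: xlogV_le_quarter.
exact: le_trans (xlogV_le_quarter x0 x4 (lexx _)) (xlogV_quarter_le y4 y2).
Qed.

(** Here [q] is the mass of a superlevel set {g >= b} on one side, [r] = 1/b^2 its Markov bound, and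
    [p] the mass of a tail. If p >= r, raise [q] to [r] and use monotonicity up to 1/2; otherwise q
    <= p < r, and ln (1/r) <= ln (1/p). *)
Lemma mul_ln_le_xlogV q r p : 0 <= q -> q <= r -> 0 < r -> r <= 4^-1 ->
  q <= p \/ r <= p -> p <= 2^-1 -> q * ln r^-1 <= xlogV p.
Proof.
move=> q0 qr r0 r4 qrp p2.
have lr : 0 <= ln r^-1 by rewrite ln_ge0// invf_ge1//; lra.
have [rp|pr] := leP r p.
  apply: (le_trans (ler_wpM2r lr qr)); exact: xlogV_mono.
have qp : q <= p by case: qrp => //; rewrite leNgt pr.
have [p0|p0] := eqVneq p 0.
  by rewrite p0 /xlogV mul0r (_ : q = 0) ?mul0r//; apply/eqP; rewrite eq_le q0 andbT -{1}p0.
have pgt0 : 0 < p by rewrite lt_neqAle eq_sym p0 (le_trans q0).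
apply: (le_trans (ler_wpM2r lr qp)); rewrite /xlogV ler_pM2l//.
by rewrite ler_ln ?posrE ?invr_gt0// lef_pV2 ?posrE// ltW.
Qed.

End xlog.

Section side_estimate.
Context {R : realType} (Phi : R -> R).
Hypothesis nPhi : nice_young Phi.
Hypothesis Phi2 : {in `]0, +oo[ &, {homo (fun x => Phi x / x ^+ 2) : x y / x <= y}}.
Variables g s n : R -> R.
Hypotheses (cg : continuous g) (ms : measurable_fun setT s)
  (mn : measurable_fun setT n).
Hypotheses (s0 : forall x, 0 <= s x) (n0 : forall x, 0 <= n x).
Local Notation leb := (@lebesgue_measure R).
Hypothesis gs : forall a b : R, a <= b ->
  (`|g b - g a|%:E <= \int[leb]_(t in `]a, b[) (s t)%:E)%E.
Variable mu : probability (measurableTypeR R) R.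
Hypothesis g_markov : forall c : R, 0 < c ->
  (mu [set x | (c <= g x)%R] <= ((c ^+ 2)^-1)%:E)%E.

(* sigma = 1 and sigma = -1 give the half-lines and segments on either side of m *)
Variables sigma m : R.
Hypothesis sigma1 : sigma = 1 \/ sigma = -1.
Definition tail (t : R) : set R := [set x | t <= sigma * (x - m)].
Definition segment (t : R) : set R := [set x | 0 <= sigma * (x - m) <= t].
Hypothesis mu_tail0 : ((2^-1)%:E <= mu (tail 0%R))%E.
Hypothesis mu_tail : forall t : R, 0 < t -> (mu (tail t) <= (2^-1)%:E)%E.
Variable B : R.
Hypothesis tail_norm : forall t : R, 0 < t ->
  ((xlogV (fine (mu (tail t))))%:E *
   orlicz_norm (fun u => 2%:E * right_derive_inv Phi u) (indic_over (segment t) n)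
   <= B%:E)%E.

Let pt (t : R) := m + sigma * t.
Let coord (x : R) := sigma * (x - m).

Let sigma_sq : sigma * sigma = 1.
Proof. by case: sigma1 => ->; rewrite ?mulr1// mulrNN mulr1. Qed.

Let ptK t : coord (pt t) = t.
Proof. by rewrite /coord /pt addrC addKr mulrA sigma_sq mul1r. Qed.

Let coordK x : pt (coord x) = x.
Proof. by rewrite /coord /pt mulrA sigma_sq mul1r addrC subrK. Qed.

Let cpt : continuous pt.
Proof. by move=> t; apply: cvgD; [exact: cvg_cst|apply: cvgMl_tmp; exact: cvg_id]. Qed.

Let ccoord : continuous coord.
Proof.
move=> x; apply: cvgMl_tmp; apply: cvgB; [exact: cvg_id|exact: cvg_cst].
Qed.

Let mcoord : measurable_fun setT coord.
Proof. exact: (continuous_measurable_fun ccoord). Qed.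

Lemma measurable_tail t : measurable (tail t).
Proof.
rewrite -[tail t]setTI (_ : tail t = coord @^-1` `[t, +oo[%classic); first exact: mcoord.
by apply/seteqP; split => x; rewrite /tail/= in_itv/= andbT.
Qed.

Let mg : measurable_fun setT g.
Proof. exact: continuous_measurable_fun. Qed.

Lemma measurable_superlevel c : measurable [set x | c <= g x].
Proof.
rewrite -[X in measurable X]setTI (_ : [set x | _] = g @^-1` `[c, +oo[%classic); first exact: mg.
by apply/seteqP; split => x; rewrite /= in_itv/= andbT.
Qed.

Definition strip (a b : R) : set R := tail 0 `&` [set x | a < g x < b].

Lemma measurable_strip a b : measurable (strip a b).
Proof.
apply: measurableI; first exact: measurable_tail.
rewrite -[X in measurable X]setTI (_ : [set x | _] = g @^-1` `]a, b[%classic); first exact: mg.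
by apply/seteqP; split => x; rewrite /= in_itv/=.
Qed.

Let orlicz_lt (t N0 N : R) : orlicz_norm (fun u => 2%:E * right_derive_inv Phi u)%E
    (indic_over (segment t) n) = N0%:E -> N0 < N ->
  exists2 N', 0 < N' < N &
    (\int[leb]_x (2%:E * right_derive_inv Phi (`|indic_over (segment t) n x| * (N'^-1)%:E)) <= 1)%E.
Proof.
move=> H N0N.
have : (orlicz_norm (fun u => 2%:E * right_derive_inv Phi u) (indic_over (segment t) n) < N%:E)%E.
  by rewrite H lte_fin.
by move=> /ereal_inf_lt[z [N' [N'0 HN'] <-]]; rewrite lte_fin => N'N; exists N' => //; rewrite N'0.
Qed.

Lemma B_ge0 : 0 <= B.
Proof.
rewrite -lee_fin; apply: le_trans (tail_norm ltr01).
rewrite mule_ge0//; first rewrite lee_fin xlogV_ge0//.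
- by rewrite fine_ge0.
- by rewrite -lee_fin fineK ?fin_num_measure ?probability_le1//; exact: measurable_tail.
- by apply/ereal_infP => _ [N [N0 _] <-]; rewrite lee_fin ltW.
Qed.

(** Every [N] admissible in the Orlicz norm satisfies b^2/4 <= N Phi(1) J by [interval_energy],
    hence so does the norm; multiplying by 4 [xlogV] of the tail brings in [B]. *)
Lemma segment_energy (b t u v : R) : 0 < b -> u <= v -> segment t u -> segment t v ->
  (g u <= b / 4 /\ b <= g v) \/ (b <= g u /\ g v <= b / 4) -> 0 < t ->
  (\int[leb]_(x in strip (b / 4) b) (energy_density Phi g s n x)%:E < +oo)%E ->
  ((xlogV (fine (mu (tail t))) * b ^+ 2)%:E <=
   (4 * Phi 1 * B)%:E * \int[leb]_(x in strip (b / 4) b) (energy_density Phi g s n x)%:E)%E.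
Proof.
move=> b0 uv tu tv guv t0.
set J := (\int[leb]_(x in strip (b / 4) b) _)%E; move=> Jfin.
have me : measurable_fun setT (fun x => (energy_density Phi g s n x)%:E).
  by apply/measurable_EFinP; exact: (measurable_energy_density nPhi).
have e0 x : (0 <= (energy_density Phi g s n x)%:E)%E.
  by rewrite lee_fin; exact: energy_density_ge0.
have J0 : (0 <= J)%E by exact: integral_ge0.
have Jf : J \is a fin_num by rewrite ge0_fin_numE.
have b4 : b / 4 < b by lra.
have [u' [v' [uu' u'v' v'v guv' Hg]]] := crossing cg b4 uv guv.
have sub x : u' < x < v' -> 0 <= sigma * (x - m) <= t.
  move=> ux; move: tu tv; rewrite /segment /=.
  by case: sigma1 => ->; lra.
have P10 : 0 < Phi 1 by apply: young_gt0 => //; exact: oner_neq0.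
have HN (N : R) : 0 < N ->
   (\int[leb]_x (2%:E * right_derive_inv Phi (`|indic_over (segment t) n x| * (N^-1)%:E)) <= 1)%E ->
   b ^+ 2 / 4 <= N * Phi 1 * fine J.
  move=> N0 intN; rewrite -lee_fin [leRHS]EFinM fineK//.
  apply: (@le_trans _ _ ((N * Phi 1)%:E *
      \int[leb]_(t in `]u', v'[) (energy_density Phi g s n t)%:E)%E).
    apply: (interval_energy nPhi Phi2 mg ms mn s0 n0 (A := segment t)) => //.
    - by move=> x /Hg; lra.
    - apply: le_trans (gs (ltW u'v')); rewrite lee_fin; apply: le_trans guv'; lra.
  apply: lee_wpmul2l; first by rewrite lee_fin mulr_ge0 ?ltW.
  apply: ge0_subset_integral => //; first exact: measurable_strip.
    exact: measurable_funTS.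
  move=> x /=; rewrite /= in_itv/= => ux; split; last exact: Hg.
  by case/andP: (sub _ ux).
have p1 : fine (mu (tail t)) <= 1.
  by rewrite -lee_fin fineK ?fin_num_measure ?probability_le1//; exact: measurable_tail.
have p0 : 0 <= fine (mu (tail t)) by rewrite fine_ge0.
have xp0 := xlogV_ge0 p0 p1.
rewrite -(fineK Jf) -EFinM lee_fin.
have J0' : 0 <= fine J by rewrite fine_ge0.
(* When this factor vanishes, [tail_norm] reads 0 <= B and the norm may be infinite; otherwise the
   bound by [B] forces the norm to be finite. *)
have [->|xpn] := eqVneq (xlogV (fine (mu (tail t)))) 0.
  by rewrite mul0r !mulr_ge0// ?(ltW P10)// B_ge0.
have xp : 0 < xlogV (fine (mu (tail t))) by rewrite lt_neqAle eq_sym xpn.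
have := tail_norm t0.
set Nrm := orlicz_norm _ _.
have Nrm0 : (0 <= Nrm)%E.
  by apply/ereal_infP => _ [N [N0 _] <-]; rewrite lee_fin ltW.
case E : Nrm Nrm0 => [N0| |]// N00; last first.
  by rewrite gt0_muley ?lte_fin// leye_eq.
rewrite -EFinM lee_fin => xNB.
have bN0 : b ^+ 2 / 4 <= N0 * Phi 1 * fine J.
  (* The infimum defining the norm need not be attained, so an admissible [N] slightly above it is
     used; the [+ 1] guards against [fine J = 0]. *)
  apply/ler_addgt0Pr => e e0'.
  have D0 : 0 < Phi 1 * fine J + 1 by rewrite ltr_wpDl// mulr_ge0// ltW.
  have [N /andP[N'0 N'N] intN] : exists2 N', 0 < N' < N0 + e / (Phi 1 * fine J + 1) &
    (\int[leb]_x (2%:E * right_derive_inv Phi (`|indic_over (segment t) n x| * (N'^-1)%:E)) <= 1)%E.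
    by apply: orlicz_lt E _; rewrite ltrDl divr_gt0.
  apply: (le_trans (HN _ N'0 intN)).
  rewrite -!mulrA; apply: (@le_trans _ _ ((N0 + e / (Phi 1 * fine J + 1)) * (Phi 1 * fine J))).
    by rewrite ler_wpM2r ?mulr_ge0 ?(ltW P10)// ltW.
  rewrite mulrDl lerD2l mulrAC -mulrA ler_piMr ?(ltW e0')//.
  by rewrite ler_pdivrMr// mul1r lerDl.
apply: (@le_trans _ _ (4 * (xlogV (fine (mu (tail t))) * (N0 * Phi 1 * fine J)))).
  by rewrite [leRHS]mulrCA ler_pM2l//; lra.
rewrite (_ : 4 * _ = 4 * Phi 1 * fine J * (xlogV (fine (mu (tail t))) * N0)); last by ring.
rewrite (_ : 4 * Phi 1 * B * fine J = 4 * Phi 1 * fine J * B); last by ring.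
by rewrite ler_wpM2l// !mulr_ge0// ltW.
Qed.

(* Let tx and tz be the first times, moving away from m, at which g reaches b and
   b/4.  The segment up to the later of the two contains a crossing of the strip;
   if it is tx, then {g >= b} lies beyond it, and if it is tz, then g > b/4 before
   it, so that the tail beyond it still has mass at least 1/4. *)
Lemma side_estimate (b : R) : 8 <= b ->
  (\int[leb]_(x in strip (b / 4) b) (energy_density Phi g s n x)%:E < +oo)%E ->
  ((fine (mu (tail 0 `&` [set x | b <= g x])) * (b ^+ 2 * ln (b ^+ 2)))%:E <=
   (4 * Phi 1 * B)%:E * \int[leb]_(x in strip (b / 4) b) (energy_density Phi g s n x)%:E)%E.
Proof.
move=> b8; set J := (\int[leb]_(x in strip (b / 4) b) _)%E; move=> Jfin.
have b0 : 0 < b by apply: lt_le_trans b8.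
have J0 : (0 <= J)%E.
  by apply: integral_ge0 => x _; rewrite lee_fin; exact: energy_density_ge0.
have b4 : b / 4 < b by lra.
have mtail0 := measurable_tail 0.
have mQ : measurable (tail 0 `&` [set x | b <= g x]).
  by apply: measurableI => //; exact: measurable_superlevel.
set q := fine _.
have q0 : 0 <= q by rewrite fine_ge0.
have sq64 : 64 <= b ^+ 2 by rewrite expr2; apply: (@le_trans _ _ (8 * 8)); [lra|apply: ler_pM].
have sq0 : 0 < b ^+ 2 by rewrite exprn_gt0.
have qr : q <= (b ^+ 2)^-1.
  rewrite -lee_fin fineK ?fin_num_measure//; apply: le_trans (g_markov b0).
  by apply: le_measure; rewrite ?inE//; exact: measurable_superlevel.
have r0 : 0 < (b ^+ 2)^-1 by rewrite invr_gt0.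
have r4 : (b ^+ 2)^-1 <= 4^-1 by rewrite lef_pV2 ?posrE//; lra.
have bound p : q <= p \/ (b ^+ 2)^-1 <= p -> p <= 2^-1 ->
    q * (b ^+ 2 * ln (b ^+ 2)) <= xlogV p * b ^+ 2.
  move=> qp p2; rewrite mulrCA mulrC ler_pM2r//.
  by have := mul_ln_le_xlogV q0 qr r0 r4 qp p2; rewrite invrK.
pose X := `[0, +oo[ `&` ((g \o pt) @^-1` [set y | b <= y]).
pose Z := `[0, +oo[ `&` ((g \o pt) @^-1` [set y | y <= b / 4]).
have cgpt : continuous (g \o pt).
  by move=> x; apply: continuous_comp; [exact: cpt|exact: cg].
have cX : closed X.
  apply: closedI; first exact: interval_closed.
  by apply: preimage_closed; [move=> x _; exact: cgpt|exact: closed_ge].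
have cZ : closed Z.
  apply: closedI; first exact: interval_closed.
  by apply: preimage_closed; [move=> x _; exact: cgpt|exact: closed_le].
have lX : has_lbound X by exists 0 => x [/=]; rewrite in_itv/= andbT.
have lZ : has_lbound Z by exists 0 => x [/=]; rewrite in_itv/= andbT.
have [X0|/set0P X0] := eqVneq X set0.
  rewrite /q (_ : tail 0 `&` _ = set0) ?measure0 ?mul0r.
    by rewrite mule_ge0// lee_fin mulr_ge0 ?B_ge0// mulr_ge0// (young_ge0 nPhi).
  rewrite -subset0 => x [x0 gx]; suff : set0 (coord x) by []; rewrite -X0; split => //=.
    by rewrite in_itv/= andbT.
  by rewrite coordK.
(* This is where b >= 8 is used: (b/4)^2 >= 4. *)
have mu_level : (mu [set x | (b / 4 <= g x)%R] <= (4^-1)%:E)%E.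
  apply: le_trans (g_markov _) _; first by rewrite divr_gt0.
  rewrite lee_fin lef_pV2 ?posrE ?exprn_gt0 ?divr_gt0//.
  by rewrite expr_div_n ler_pdivlMr ?exprn_gt0//; lra.
(* Otherwise g > b/4 on the whole side, whose mass is at least 1/2. *)
have Z0 : Z !=set0.
  apply/set0P/negP => /eqP Z0.
  suff : (mu (tail 0%R) <= (4^-1)%:E)%E.
    by move=> /(le_trans mu_tail0); rewrite lee_fin; lra.
  apply: le_trans mu_level; apply: le_measure; rewrite ?inE//.
    exact: measurable_superlevel.
  move=> x x0 /=; rewrite leNgt; apply/negP => gx.
  suff : set0 (coord x) by [].
  rewrite -Z0; split; rewrite /= ?coordK ?ltW//.
  by rewrite in_itv/= andbT.
have [/=] := inf_closed_mem cX X0 lX.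
have [/=] := inf_closed_mem cZ Z0 lZ.
set tz : R := inf Z; set tx : R := inf X.
rewrite !in_itv/= !andbT => tz0 gtz tx0 gtx.
have seg (t' t : R) : 0 <= t' -> t' <= t -> segment t (pt t').
  by move=> t'0 t't; rewrite /segment /= -[sigma * _]/(coord (pt t')) ptK t'0.
have p2 (t : R) : 0 < t -> fine (mu (tail t)) <= 2^-1.
  move=> t0; rewrite -lee_fin fineK ?fin_num_measure//; last exact: measurable_tail.
  exact: mu_tail.
have [xz|zx|xz] := ltgtP tx tz; last first.
- by move: (le_lt_trans gtz b4); rewrite -xz ltNge gtx.
(* Strict positivity matters: the closed half-line starting at [m] may have mass above 1/2, the
   later ones may not. *)
- have t0 := le_lt_trans tz0 zx.
  apply: (@le_trans _ _ (xlogV (fine (mu (tail tx))) * b ^+ 2)%:E).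
    rewrite lee_fin; apply: bound; last exact: p2.
    left; rewrite -lee_fin !fineK ?fin_num_measure//; last exact: measurable_tail.
    apply: le_measure; rewrite ?inE//; first exact: measurable_tail.
    move=> x [x0 gx]; apply: inf_lbound => //; split => /=; last by rewrite coordK.
    by rewrite in_itv/= andbT.
  (* For [sigma = -1] the map [pt] reverses the order, so a crossing upward when moving away from
     [m] is downward on the line. *)
  have [uv|vu] := leP (pt tz) (pt tx).
    by apply: (segment_energy b0 uv) => //; [apply: seg => //; exact: ltW|exact: seg|left].
  by apply: (segment_energy b0 (ltW vu)) => //; [exact: seg|apply: seg => //; exact: ltW|right].
- have t0 := le_lt_trans tx0 xz.
  apply: (@le_trans _ _ (xlogV (fine (mu (tail tz))) * b ^+ 2)%:E).
    rewrite lee_fin; apply: bound; last exact: p2.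
    right; apply: (le_trans r4).
    have : (mu (tail 0%R) <= mu (tail tz) + mu [set x | (b / 4 <= g x)%R])%E.
      apply: (@le_trans _ _ (mu (tail tz `|` [set x | (b / 4 <= g x)%R]))); last first.
        by apply: measureU2; [exact: measurable_tail|exact: measurable_superlevel].
      apply: le_measure; rewrite ?inE//.
        by apply: measurableU; [exact: measurable_tail|exact: measurable_superlevel].
      move=> x x0; have [tzx|xtz] := leP tz (coord x); [by left|right => /=].
      rewrite leNgt; apply/negP => gx.
      suff : tz <= coord x by rewrite leNgt xtz.
      apply: inf_lbound => //; split; rewrite /= ?coordK ?ltW//.
      by rewrite in_itv/= andbT.
    move=> /(le_trans mu_tail0)/le_trans/(_ (leeD2l _ mu_level)).
    rewrite -leeBlDr// -EFinB -[X in (_ <= X)%E]fineK ?fin_num_measure//; last exact: measurable_tail.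
    by rewrite lee_fin => /(le_trans _); apply; lra.
  have [uv|vu] := leP (pt tx) (pt tz).
    by apply: (segment_energy b0 uv) => //; [apply: seg => //; exact: ltW|exact: seg|right].
  by apply: (segment_energy b0 (ltW vu)) => //; [exact: seg|apply: seg => //; exact: ltW|left].
Qed.

End side_estimate.

(** * Integration against a measure given by its density *)

Section density.
Local Open Scope ereal_scope.
Context d (T : measurableType d) {R : realType}.
Variables (lam nu : {measure set T -> \bar R}) (n : T -> R).
Hypotheses (mn : measurable_fun setT n) (n0 : forall x, (0 <= n x)%R).
Hypothesis nuE : forall A, measurable A -> nu A = \int[lam]_(x in A) (n x)%:E.

Import HBNNSimple.

Let integral_density_nnsfun (h : {nnsfun T >-> R}) :
  \int[nu]_x (h x)%:E = \int[lam]_x (h x * n x)%:E.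
Proof.
have mind y : measurable_fun setT (fun x => (y * \1_(h @^-1` [set y]) x)%:E).
  by apply/measurable_EFinP; exact: measurable_funM.
have ind0 y x : 0 <= (y * \1_(h @^-1` [set y]) x)%:E by exact: nnfun_muleindic_ge0.
transitivity (\sum_(y \in range h) \int[nu]_x (y * \1_(h @^-1` [set y]) x)%:E).
  rewrite -ge0_integral_fsum//; apply: eq_integral => x _.
  by rewrite [in LHS]fimfunE -fsumEFin.
transitivity (\sum_(y \in range h) \int[lam]_x (y * \1_(h @^-1` [set y]) x * n x)%:E).
  apply: eq_fsbigr => y /set_mem[t _ <-].
  under eq_integral do rewrite EFinM.
  under [RHS]eq_integral do rewrite -mulrA EFinM.
  rewrite !ge0_integralZl//; last 5 first.
  - by apply/measurable_EFinP; apply: measurable_funM.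
  - by move=> x _; rewrite lee_fin mulr_ge0.
  - by rewrite lee_fin.
  - exact/measurable_EFinP.
  - by rewrite lee_fin.
  congr (_ * _); rewrite integral_indic//= setIT nuE// integral_mkcond.
  apply: eq_integral => x _; rewrite patchE indicE.
  by case: ifPn => _; rewrite ?mul1r ?mul0r.
rewrite -ge0_integral_fsum//.
- apply: eq_integral => x _.
  rewrite [in RHS]fimfunE EFinM -fsumEFin// ge0_mule_fsuml//.
- by move=> y; apply/measurable_EFinP; apply: measurable_funM => //; exact: measurable_funM.
- by move=> y x _; rewrite EFinM mule_ge0// lee_fin.
Qed.

Lemma integral_density (f : T -> R) : measurable_fun setT f ->
  (forall x, (0 <= f x)%R) -> \int[nu]_x (f x)%:E = \int[lam]_x (f x * n x)%:E.
Proof.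
move=> mf f0.
have mf' : measurable_fun setT (EFin \o f) by exact/measurable_EFinP.
have f0' x : setT x -> 0 <= (EFin \o f) x by rewrite /= lee_fin.
pose h := nnsfun_approx measurableT mf'.
have hf x : (h k x)%:E @[k --> \oo] --> (f x)%:E.
  exact: (cvg_nnsfun_approx measurableT mf' f0').
have ndh x : {homo (fun k => h k x) : a b / (a <= b)%N >-> (a <= b)%R}.
  by move=> a b ab; exact/lefP/nd_nnsfun_approx.
have -> : \int[nu]_x (f x)%:E = lim (\int[nu]_x (h k x)%:E @[k --> \oo]).
  rewrite -monotone_convergence//.
  - by apply: eq_integral => x _; apply/esym/cvg_lim => //; exact: hf.
  - by move=> k; exact/measurable_EFinP.
  - by move=> k x _; rewrite lee_fin.
  - by move=> x _ a b ab; rewrite lee_fin; exact: ndh.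
under eq_fun do rewrite integral_density_nnsfun.
rewrite -monotone_convergence//.
- apply: eq_integral => x _; apply/cvg_lim => //.
  under eq_fun do rewrite EFinM.
  rewrite EFinM; apply: cvgeZr => //; exact: hf.
- by move=> k; apply/measurable_EFinP; exact: measurable_funM.
- by move=> k x _; rewrite lee_fin mulr_ge0.
- by move=> x _ a b ab; rewrite lee_fin ler_wpM2r//; exact: ndh.
Qed.

End density.

(** * Dyadic layers *)

Section dyadic.
Context {R : realType}.
Implicit Types x : R.

(** Starting at 16 keeps every level above the threshold 8 of [side_estimate], and makes 33 = 2 * 16
    + 1 the constant of the quadratic term below the first level. *)
Definition level (j : nat) : R := 2 ^+ (j + 4).

Lemma level_ge16 j : 16 <= level j.
Proof.
rewrite /level exprD (_ : 2 ^+ 4 = 16 :> R); last by rewrite !exprS expr0; lra.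
by rewrite ler_peMl// exprn_ege1// ler1n.
Qed.

Lemma level_gt0 j : 0 < level j.
Proof. by rewrite exprn_gt0. Qed.

Lemma levelS j : level j.+1 = 2 * level j.
Proof. by rewrite /level addSn exprS. Qed.

Definition sqln x : R := x ^+ 2 * ln (x ^+ 2).

Lemma sqln_level j : sqln (level j) = (level j) ^+ 2 * (2 * ln 2 * (j + 4)%:R).
Proof.
rewrite /sqln; congr (_ * _); rewrite /level -exprM lnXn//.
by rewrite -(mulr_natr (ln 2)) natrM; ring.
Qed.

Lemma ln2_gt0 : 0 < ln 2 :> R.
Proof. by rewrite ln_gt0// ltr1n. Qed.

Lemma sqln_level_ge0 j : 0 <= sqln (level j).
Proof.
by rewrite sqln_level mulr_ge0 ?sqr_ge0// mulr_ge0// mulr_ge0// ltW// ln2_gt0.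
Qed.

(** Doubling multiplies the square by 4 and the logarithm by (j+5)/(j+4) <= 5/4. Each increment is
    thus at most 4 times the previous value, which is the weight 4 in [layers]. *)
Lemma sqln_levelS j : sqln (level j.+1) <= 5 * sqln (level j).
Proof.
rewrite !sqln_level levelS -subr_ge0.
rewrite (_ : _ - _ = level j ^+ 2 * (2 * ln 2 * j%:R)).
  by rewrite mulr_ge0 ?sqr_ge0// mulr_ge0// mulr_ge0// ltW// ln2_gt0.
by rewrite !natrD -(natr1 j); ring.
Qed.

(** With ln x <= x - 1 the left side is at most 2 x^3 - 3 x^2 + 1, which factors exactly as the
    right side. *)
Lemma sqln_small x : 0 <= x -> sqln x - x ^+ 2 + 1 <= (2 * x + 1) * (x - 1) ^+ 2.
Proof.
rewrite le_eqVlt => /predU1P[<-|x0].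
  by rewrite /sqln expr0n/= mul0r; lra.
have := ln_leB1 x0; rewrite -(ler_pM2l (_ : 0 < 2 * x ^+ 2)) ?mulr_gt0 ?exprn_gt0// => H.
rewrite /sqln lnXn// -(mulr_natr (ln x)); nra.
Qed.

Lemma sqln_level_sum x K : 0 <= x -> x < level K ->
  sqln x - x ^+ 2 + 1 - 33 * (x - 1) ^+ 2 <=
  \sum_(j < K) 4 * sqln (level j) * (level j <= x)%R%:R.
Proof.
move=> x0; elim: K => [x16|K IH xK].
  rewrite big_ord0; have {}x16 : x <= 16.
    by apply: (le_trans (ltW x16)); rewrite /level add0n !exprS expr0; lra.
  have := sqln_small x0; have : 0 <= (x - 1) ^+ 2 by exact: sqr_ge0.
  nra.
have [xK'|Kx] := ltP x (level K).
  rewrite big_ord_recr/= (leNgt (level K)) xK' mulr0 addr0; exact: IH.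
have x16 : 16 <= x := le_trans (level_ge16 K) Kx.
rewrite (eq_bigr (fun j : 'I_K.+1 => 4 * sqln (level j))); last first.
  move=> j _; rewrite (_ : _ <= x) ?mulr1//.
  by apply: le_trans Kx; rewrite /level ler_weXn2l ?ler1n// leq_add2r -ltnS.
(* [sqln x] is raised to the next level so that the sum telescopes; the subtracted [sqln (level 0)]
   = 2048 ln 2 is absorbed by x^2 - 1 + 33 (x - 1)^2, as x >= 16. *)
apply: (@le_trans _ _ (sqln (level K.+1) - sqln (level 0))).
  have sqx : sqln x <= sqln (level K.+1).
    have xx : x ^+ 2 <= level K.+1 ^+ 2.
      by apply: lerXn2r; rewrite ?nnegrE//; exact: ltW (level_gt0 _) || exact: ltW.
    have x20 : 0 < x ^+ 2 by rewrite exprn_gt0//; lra.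
    have L20 : 0 < level K.+1 ^+ 2 by rewrite exprn_gt0// level_gt0.
    apply: ler_pM => //; first exact: ltW.
      by rewrite ln_ge0//; nra.
    by rewrite ler_ln ?posrE.
  have ln21 : ln 2 <= 1 :> R by have := @ln_leB1 R 2 (ltr0n _ 2); lra.
  have s16 : sqln (level 0) <= 2048.
    by rewrite sqln_level /level add0n !exprS expr0; have := ln2_gt0; lra.
  nra.
elim: K {IH xK Kx} => [|K IH]; first by rewrite big_ord_recr big_ord0/= add0r; have := sqln_levelS 0; lra.
by rewrite big_ord_recr/=; have := sqln_levelS K.+1; lra.
Qed.

Lemma lt_level x : exists K, x < level K.
Proof.
exists (Num.truncn x).+1.
apply: (lt_le_trans (truncnS_gt x)).
rewrite /level -natrX ler_nat; apply: ltnW; apply: leq_trans (ltn_expl _ (isT : (1 < 2)%N)) _.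
by rewrite leq_exp2l// leq_addr.
Qed.

Definition layers x : \bar R :=
  (\sum_(0 <= j <oo) (4 * sqln (level j) * (level j <= x)%R%:R)%:E)%E.

Lemma layers_ge0 x : (0 <= layers x)%E.
Proof.
by apply: nneseries_ge0 => j _ _; rewrite lee_fin mulr_ge0// mulr_ge0// sqln_level_ge0.
Qed.

Lemma sqln_le_layers x : 0 <= x ->
  ((sqln x - x ^+ 2 + 1 - 33 * (x - 1) ^+ 2)%:E <= layers x)%E.
Proof.
move=> x0; have [K xK] := lt_level x.
have := sqln_level_sum x0 xK; rewrite -lee_fin => /le_trans; apply.
rewrite -sumEFin -(big_mkord xpredT (fun j => (4 * sqln (level j) * (level j <= x)%R%:R)%:E)).
apply: nneseries_lim_ge => j _ _.
by rewrite lee_fin mulr_ge0// mulr_ge0// sqln_level_ge0.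
Qed.

(** The strip of index j is (2^(j+2), 2^(j+4)), so its indicator is at most [v (j + 2) - v (j + 4)].
    The sum telescopes with step two and leaves at most [v 2 + v 3]. *)
Lemma strip_series x :
  (\sum_(0 <= j <oo) ((level j / 4 < x < level j)%R%:R : R)%:E <= 2%:E)%E.
Proof.
pose v j : R := (2 ^+ j < x)%R%:R.
have v01 j : 0 <= v j <= 1 by rewrite /v; case: ltP; rewrite ?lexx ?ler01.
have vS j : v j.+1 <= v j.
  rewrite /v; case: ltP => //= x1; case: ltP => // x2.
  suff : 2 ^+ j <= 2 ^+ j.+1 :> R by rewrite leNgt (lt_le_trans x1 x2).
  by rewrite ler_weXn2l// ler1n.
have H j : (level j / 4 < x < level j)%R%:R <= v (j + 2)%N - v (j + 4)%N.
  have -> : level j / 4 = 2 ^+ (j + 2).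
    by rewrite /level -[4%N]/(2 + 2)%N addnA exprD (_ : 2 ^+ 2 = 4 :> R) ?mulfK// expr2; lra.
  rewrite /v /level; case: (ltP (2 ^+ (j + 2)) x) => [x2|x2] /=.
    by case: (ltP x (2 ^+ (j + 4))) => x4; case: ltP; rewrite ?subr0 ?subrr//; lra.
  have x4 : x <= 2 ^+ (j + 4) by apply: (le_trans x2); rewrite ler_weXn2l ?ler1n// leq_add2l.
  by rewrite ltNge x4/= subrr.
apply: lime_le.
  by apply: is_cvg_nneseries => j _ _; rewrite lee_fin.
apply: nearW => N; rewrite big_mkord sumEFin lee_fin.
apply: (@le_trans _ _ (v 2%N + v 3%N - v (N + 2)%N - v (N + 3)%N)); last first.
  have := v01 2%N; have := v01 3%N; have := v01 (N + 2)%N; have := v01 (N + 3)%N; lra.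
elim: N => [|N IH]; first by rewrite big_ord0 !add0n; lra.
rewrite big_ord_recr/=; have := H N; move: IH.
rewrite (_ : N.+1 + 2 = N + 3)%N; last by rewrite addSnnS.
rewrite (_ : N.+1 + 3 = N + 4)%N; last by rewrite addSnnS.
lra.
Qed.

End dyadic.

(** * Summation over the levels and over both sides of the median *)

Section layers.
Context {R : realType} (Phi : R -> R).
Hypothesis nPhi : nice_young Phi.
Hypothesis Phi2 : {in `]0, +oo[ &, {homo (fun x => Phi x / x ^+ 2) : x y / x <= y}}.
Variables g s n : R -> R.
Hypotheses (cg : continuous g) (ms : measurable_fun setT s)
  (mn : measurable_fun setT n).
Hypotheses (s0 : forall x, 0 <= s x) (n0 : forall x, 0 <= n x).
Local Notation leb := (@lebesgue_measure R).
Hypothesis gs : forall a b : R, a <= b ->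
  (`|g b - g a|%:E <= \int[leb]_(t in `]a, b[) (s t)%:E)%E.
Variable mu : probability (measurableTypeR R) R.
Hypothesis g_markov : forall c : R, 0 < c ->
  (mu [set x | (c <= g x)%R] <= ((c ^+ 2)^-1)%:E)%E.
Variables m B : R.
Hypothesis mum : median mu m.
Hypothesis CpB : (C_plus mu Phi n m <= B%:E)%E.
Hypothesis CmB : (C_minus mu Phi n m <= B%:E)%E.

Let e := energy_density Phi g s n.
Hypothesis e_fin : (\int[leb]_x (e x)%:E < +oo)%E.

Let me : measurable_fun setT (fun x => (e x)%:E).
Proof.
apply/measurable_EFinP; apply: (measurable_energy_density nPhi) => //.
exact: continuous_measurable_fun.
Qed.

Let e0 x : (0 <= (e x)%:E)%E.
Proof. by rewrite lee_fin; exact: energy_density_ge0. Qed.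

Let tailp t : tail 1 m t = `[m + t, +oo[%classic.
Proof. by apply/seteqP; split => x; rewrite /tail/= in_itv/= andbT mul1r; lra. Qed.

Let tailm t : tail (-1) m t = `]-oo, m - t]%classic.
Proof. by apply/seteqP; split => x; rewrite /tail/= in_itv/= mulN1r; lra. Qed.

Let segp t : segment 1 m t = `[m, m + t]%classic.
Proof. by apply/seteqP; split => x; rewrite /segment/= in_itv/= mul1r; lra. Qed.

Let segm t : segment (-1) m t = `[m - t, m]%classic.
Proof. by apply/seteqP; split => x; rewrite /segment/= in_itv/= mulN1r; lra. Qed.

Let mu_half (A A' : set (measurableTypeR R)) : measurable A -> measurable A' ->
  A `<=` ~` A' -> ((2^-1)%:E <= mu A')%E -> (mu A <= (2^-1)%:E)%E.
Proof.
move=> mA mA' AA' muA'.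
apply: (@le_trans _ _ (mu (~` A'))); first by apply: le_measure; rewrite ?inE//; exact: measurableC.
rewrite probability_setC//.
apply: (@le_trans _ _ (1%:E - (2^-1)%:E)%E); first exact: leeB.
by rewrite -EFinB lee_fin; lra.
Qed.

Let tail_norm_p t : 0 < t -> ((xlogV (fine (mu (tail 1 m t))))%:E *
   orlicz_norm (fun u => 2%:E * right_derive_inv Phi u) (indic_over (segment 1 m t) n)
   <= B%:E)%E.
Proof.
move=> t0; rewrite tailp segp; apply: le_trans CpB; apply: ereal_sup_ubound.
by exists (m + t) => //=; lra.
Qed.

Let side_p (b : R) : 8 <= b ->
  ((fine (mu (tail 1 m 0 `&` [set x | b <= g x])) * sqln b)%:E <=
   (4 * Phi 1 * B)%:E * \int[leb]_(x in strip g 1 m (b / 4) b) (e x)%:E)%E.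
Proof.
move=> b8; apply: (side_estimate nPhi Phi2 cg ms mn s0 n0 gs g_markov (or_introl erefl) _ _ tail_norm_p b8).
- by rewrite tailp addr0; exact: mum.2.
- move=> t t0; rewrite tailp; apply: mu_half mum.1 => // x.
  by rewrite /= !in_itv/=; lra.
- apply: le_lt_trans e_fin; apply: ge0_subset_integral => //.
  exact: measurable_strip.
Qed.

Let side_m (b : R) : 8 <= b ->
  ((fine (mu (tail (-1) m 0 `&` [set x | b <= g x])) * sqln b)%:E <=
   (4 * Phi 1 * B)%:E * \int[leb]_(x in strip g (-1) m (b / 4) b) (e x)%:E)%E.
Proof.
move=> b8; apply: (side_estimate nPhi Phi2 cg ms mn s0 n0 gs g_markov (or_intror erefl) _ _ _ b8).
- by rewrite tailm subr0; exact: mum.1.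
- move=> t t0; rewrite tailm; apply: mu_half mum.2 => // x.
  by rewrite /= !in_itv/=; lra.
- move=> t t0; rewrite tailm segm; apply: le_trans CmB; apply: ereal_sup_ubound.
  by exists (m - t) => //=; lra.
- apply: le_lt_trans e_fin; apply: ge0_subset_integral => //.
  exact: measurable_strip.
Qed.

Let strips sigma : measurable (tail sigma m 0) ->
  (\sum_(0 <= j <oo) \int[leb]_(x in strip g sigma m (level j / 4) (level j)) (e x)%:E
   <= 2%:E * \int[leb]_(x in tail sigma m 0) (e x)%:E)%E.
Proof.
move=> mT.
pose I j x : \bar R := (level j / 4 < g x < level j)%R%:R%:E.
have mI j : measurable_fun setT (I j).
  have -> : I j = EFin \o \1_(g @^-1` `]level j / 4, level j[%classic).
    apply/funext => x; rewrite /I /= indicE.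
    rewrite (_ : (x \in _) = (level j / 4 < g x < level j))//.
    by apply/idP/idP; rewrite inE /= in_itv.
  apply/measurable_EFinP/measurable_indic; rewrite -[X in measurable X]setTI.
  exact: continuous_measurable_fun.
have I0 j x : (0 <= I j x)%E by rewrite lee_fin.
have -> : (\sum_(0 <= j <oo) \int[leb]_(x in strip g sigma m (level j / 4) (level j)) (e x)%:E =
    \int[leb]_(x in tail sigma m 0) \sum_(0 <= j <oo) ((e x)%:E * I j x))%E.
  rewrite integral_nneseries//.
  - apply: eq_eseriesr => j _; rewrite /strip integral_mkcondr.
    apply: eq_integral => x _; rewrite patchE /I.
    case: ifPn => [/set_mem /= ->|]; first by rewrite mule1.
    by rewrite notin_setE /= => /negP/negbTE ->; rewrite mule0.
  - by move=> j; apply: measurable_funTS; by apply: emeasurable_funM; [exact: me|exact: mI].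
  - by move=> j x _; exact: mule_ge0.
rewrite -ge0_integralZl//; last exact: measurable_funTS.
apply: ge0_le_integral => //.
- by move=> x _; apply: nneseries_ge0 => j _ _; exact: mule_ge0.
- apply: measurable_funTS; apply: (@ge0_emeasurable_sum _ _ _ _ _ xpredT) => [j x _ _|j _].
     exact: mule_ge0.
  by apply: emeasurable_funM; [exact: me|exact: mI].
- by apply: measurable_funTS; apply: emeasurable_funM => //; exact: me.
- move=> x _; rewrite nneseriesZl//.
  by rewrite muleC lee_wpmul2r//; exact: strip_series.
Qed.

Lemma layer_integral :
  (\int[mu]_x layers (g x) <= (32 * Phi 1 * B)%:E * \int[leb]_x (e x)%:E)%E.
Proof.
have mT sigma : measurable (tail sigma m 0) by exact: measurable_tail.
have mL (b : R) : measurable [set x | b <= g x] by exact: measurable_superlevel.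
have mTL sigma (b : R) : measurable (tail sigma m 0 `&` [set x | b <= g x]).
  by apply: measurableI; [exact: mT|exact: mL].
have B0 : 0 <= B.
  by apply: (@B_ge0 _ Phi n mu 1 m); exact: tail_norm_p.
have P10 : 0 <= Phi 1 := young_ge0 nPhi 1.
pose J sigma j := (\int[leb]_(x in strip g sigma m (level j / 4) (level j)) (e x)%:E)%E.
have J0 sigma j : (0 <= J sigma j)%E by exact: integral_ge0.
have L0 j := @sqln_level_ge0 R j.
have L8 j : 8 <= level j :> R by have := @level_ge16 R j; lra.
have indE j : (fun x => (level j <= g x)%R%:R) = \1_[set x | level j <= g x] :> (R -> R).
  apply/funext => x; rewrite indicE; congr (_%:R).
  by congr nat_of_bool; apply/idP/idP; rewrite inE.
rewrite /layers integral_nneseries//; last 2 first.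
- move=> j; apply/measurable_EFinP; apply: measurable_funM => //.
  by rewrite indE; apply: measurable_indic; exact: mL.
- by move=> j x _; rewrite lee_fin mulr_ge0// mulr_ge0.
have -> : (\sum_(0 <= j <oo) \int[mu]_x (4 * sqln (level j) * (level j <= g x)%R%:R)%:E =
   \sum_(0 <= j <oo) (4 * sqln (level j))%:E * mu [set x | level j <= g x]%R)%E.
  apply: eq_eseriesr => j _; under eq_integral do rewrite EFinM.
  rewrite ge0_integralZl//; last 2 first.
  - by apply/measurable_EFinP; rewrite indE; apply: measurable_indic; exact: mL.
  - by rewrite lee_fin mulr_ge0.
  have -> : (\int[mu]_x ((level j <= g x)%R%:R : R)%:E =
      \int[mu]_x (\1_[set x | (level j <= g x)%R] x)%:E)%E.
    by apply: eq_integral => x _; rewrite -indE.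
  by rewrite integral_indic//; [congr (_ * mu _)%E; exact: setIT|exact: mL].
apply: (@le_trans _ _ (\sum_(0 <= j <oo) (16 * Phi 1 * B)%:E * (J 1%R j + J (-1)%R j))%E).
  apply: lee_nneseries => [j _ _|j _]; first by rewrite mule_ge0// lee_fin mulr_ge0.
  have muL : (mu [set x | (level j <= g x)%R] <=
      mu (tail 1 m 0%R `&` [set x | (level j <= g x)%R]) +
      mu (tail (-1)%R m 0%R `&` [set x | (level j <= g x)%R]))%E.
    apply: le_trans (measureU2 _ _ _); [|exact: mTL|exact: mTL].
    apply: le_measure; rewrite ?inE//; [exact: mL|by apply: measurableU; exact: mTL|].
    move=> x /= gx; rewrite /tail /= !mul1r !mulN1r.
    by have [mx|xm] := leP 0 (x - m); [left|right]; split => //=; lra.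
  apply: (@le_trans _ _ (4%:E *
      ((fine (mu (tail 1 m 0%R `&` [set x | (level j <= g x)%R])) * sqln (level j))%:E +
      (fine (mu (tail (-1)%R m 0%R `&` [set x | (level j <= g x)%R])) * sqln (level j))%:E))%E).
    have {muL} : fine (mu [set x | (level j <= g x)%R]) <=
        fine (mu (tail 1 m 0%R `&` [set x | (level j <= g x)%R])) +
        fine (mu (tail (-1)%R m 0%R `&` [set x | (level j <= g x)%R])).
      by rewrite -lee_fin EFinD !fineK ?fin_num_measure//; [exact: mTL|exact: mTL|exact: mL].
    rewrite -[mu [set x | (level j <= g x)%R]]fineK ?fin_num_measure//; last exact: mL.
    rewrite -EFinD -!EFinM lee_fin -mulrDl mulrA => muL.
    rewrite [leRHS]mulrAC; apply: ler_wpM2l => //; first by rewrite mulr_ge0.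
  rewrite (_ : (16 * Phi 1 * B)%:E = 4%:E * (4 * Phi 1 * B)%:E)%E; last by rewrite -EFinM; congr EFin; ring.
  rewrite -muleA lee_wpmul2l// ge0_muleDr//.
  by apply: leeD; [exact: side_p|exact: side_m].
rewrite nneseriesZl; last by move=> j _; apply: adde_ge0; exact: J0.
rewrite nneseriesD; [|by move=> j _ _; exact: J0|by move=> j _ _; exact: J0].
apply: (@le_trans _ _ ((16 * Phi 1 * B)%:E * (2%:E * \int[leb]_(x in tail 1 m 0%R) (e x)%:E
    + 2%:E * \int[leb]_(x in tail (-1)%R m 0%R) (e x)%:E))%E).
  by apply: lee_wpmul2l; [rewrite lee_fin !mulr_ge0|apply: leeD; exact: strips].
rewrite -ge0_muleDr ?integral_ge0// muleA -EFinM.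
rewrite (_ : 16 * Phi 1 * B * 2 = 32 * Phi 1 * B); last by ring.
rewrite tailp tailm addr0 subr0 addeC.
(* Both sides contain [m]; dropping this null point makes them a partition of the line. *)
rewrite -integral_itv_bndo_bndc; last exact: measurable_funTS.
rewrite -ge0_integral_setU//=.
- by rewrite -itv_bndbnd_setU//= set_itvNyy.
- exact: measurable_funTS.
- apply/disj_setPS => x [] /=; rewrite !in_itv/= andbT => xm mx.
  by move: (lt_le_trans xm mx); rewrite ltxx.
Qed.

End layers.

(** * Variance and entropy *)

Section real_integrable.
Context d (T : measurableType d) {R : realType} (mu : probability T R).
Implicit Types f h : T -> R.

Definition rintegrable f := mu.-integrable setT (EFin \o f).

Lemma rintegrable_measurable f : rintegrable f -> measurable_fun setT f.
Proof. by move=> /integrableP[/measurable_EFinP]. Qed.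

Lemma rintegrable_cst (c : R) : rintegrable (fun=> c).
Proof. exact: finite_measure_integrable_cst. Qed.

Lemma rintegrableD f h : rintegrable f -> rintegrable h -> rintegrable (fun x => f x + h x).
Proof. by move=> fi hi; exact: (integrableD measurableT fi hi). Qed.

Lemma rintegrableB f h : rintegrable f -> rintegrable h -> rintegrable (fun x => f x - h x).
Proof. by move=> fi hi; exact: (integrableB measurableT fi hi). Qed.

Lemma rintegrableZ (c : R) f : rintegrable f -> rintegrable (fun x => c * f x).
Proof. by move=> fi; exact: (integrableZl measurableT c fi). Qed.

Lemma le_rintegrable f h : measurable_fun setT f -> (forall x, `|f x| <= h x) ->
  rintegrable h -> rintegrable f.
Proof.
move=> mf fh; apply: le_integrable => //; first exact/measurable_EFinP.
by move=> x _; rewrite /= lee_fin (le_trans (fh x))// ler_norm.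
Qed.

Lemma ge0_rintegrable f : measurable_fun setT f -> (forall x, 0 <= f x) ->
  (\int[mu]_x (f x)%:E < +oo)%E -> rintegrable f.
Proof.
move=> mf f0 fi; apply/integrableP; split; first exact/measurable_EFinP.
by under eq_integral do rewrite /= ger0_norm//.
Qed.

Lemma rintegralE f : rintegrable f -> (\int[mu]_x (f x)%:E = (\int[mu]_x f x)%R%:E)%E.
Proof. by move=> fi; rewrite /Rintegral fineK//; exact: integrable_fin_num fi. Qed.

(* Truncation below at e keeps Poincare's inequality away from the zeros of X. *)
Lemma second_moment_truncation (X : T -> R) (v : R) : measurable_fun setT X ->
  (forall x, 0 <= X x) ->
  (forall e : R, 0 < e -> ('V_mu[fun x => Num.max (X x - e)%R 0%R] <= v%:E)%E) ->
  [/\ rintegrable X, rintegrable (fun x => X x ^+ 2) &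
   (\int[mu]_x (X x ^+ 2) - (\int[mu]_x X x) ^+ 2 <= v)%R].
Proof.
move=> mX X0 HV.
pose Y (e : R) x := Num.max (X x - e) 0.
have mY e : measurable_fun setT (Y e).
  by apply: measurable_maxr => //; exact: measurable_funB.
pose c e := fine ('E_mu[Y e])%E.
have VE e : ('V_mu[Y e] = \int[mu]_x ((Y e x - c e) ^+ 2)%:E)%E.
  rewrite /variance unlock /c unlock.
  by apply: eq_integral => x _; rewrite expr2.
have Y0 e x : 0 <= Y e x by rewrite le_max lexx orbT.
have c0 e : 0 <= c e by rewrite fine_ge0// expectation_ge0.
have mYc e : measurable_fun setT (fun x => (Y e x - c e) ^+ 2).
  by apply: measurable_funX; exact: measurable_funB.
have iYc e : 0 < e -> rintegrable (fun x => (Y e x - c e) ^+ 2).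
  move=> e0; apply: ge0_rintegrable => //; first by move=> x; exact: sqr_ge0.
  by rewrite -VE (le_lt_trans (HV _ e0))// ltry.
have iX2 : rintegrable (fun x => X x ^+ 2).
  (* Square integrability is a conclusion here: truncation at 1 changes [X] by at most 1, and the
     truncated function has finite variance. *)
  apply: (@le_rintegrable _ (fun x => 2 * (Y 1 x - c 1) ^+ 2 + 2 * (c 1 + 1) ^+ 2)).
  - exact: measurable_funX.
  - move=> x; rewrite ger0_norm ?sqr_ge0//.
    have XY : X x <= Y 1 x + 1 by rewrite -lerBlDr le_max lexx.
    have : X x <= `|Y 1 x - c 1| + (c 1 + 1).
      by have := ler_norm (Y 1 x - c 1); lra.
    move=> H; have : X x ^+ 2 <= (`|Y 1 x - c 1| + (c 1 + 1)) ^+ 2.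
      by apply: lerXn2r; rewrite ?nnegrE// addr_ge0// addr_ge0.
    rewrite -(real_normK (num_real (Y 1 x - c 1))).
    by have := sqr_ge0 (`|Y 1 x - c 1| - (c 1 + 1)); nra.
  - by apply: rintegrableD; [exact/rintegrableZ/iYc|exact: rintegrable_cst].
have iX : rintegrable X.
  apply: (@le_rintegrable _ (fun x => X x ^+ 2 + 1)) => //.
    by move=> x; rewrite ger0_norm//; have := sqr_ge0 (X x - 1); nra.
  by apply: rintegrableD => //; exact: rintegrable_cst.
split => //.
set M := (X in X - _ <= _); set A := Rintegral _ _ _.
have A0 : 0 <= A by exact: Rintegral_ge0.
apply/ler_addgt0Pr => e' e'0.
pose e := e' / (2 * A + 1).
have D0 : 0 < 2 * A + 1 by lra.
have e0 : 0 < e by rewrite divr_gt0.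
apply: (@le_trans _ _ (v + 2 * e * A)); last first.
  rewrite lerD2l /e (_ : 2 * _ * A = e' * (2 * A / (2 * A + 1))); last by ring.
  by rewrite ler_piMr ?(ltW e'0)// ler_pdivrMr// mul1r; lra.
have iY : rintegrable (Y e).
  apply: le_rintegrable iX => // x; rewrite ger0_norm// ge_max X0 andbT.
  by rewrite gerBl ltW.
have cE : c e = (\int[mu]_x Y e x)%R by rewrite /c unlock.
have cA : c e <= A.
  rewrite cE; apply: le_Rintegral => // x _; rewrite ge_max X0 andbT.
  by rewrite gerBl ltW.
have : (\int[mu]_x ((Y e x - c e) ^+ 2) <= v)%R.
  by rewrite -lee_fin -rintegralE ?iYc// -VE HV.
(* A minorant of (Y - c)^2, since X^2 - 2 e X <= Y^2; its integral is M - 2 e A - c^2 with c <= A,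
   and [e] was chosen so that 2 e A <= e'. *)
pose h x := X x ^+ 2 - (2 * e) * X x - (2 * c e) * Y e x + c e ^+ 2.
have ih : rintegrable h.
  apply: rintegrableD; last exact: rintegrable_cst.
  apply: rintegrableB; last exact: rintegrableZ.
  by apply: rintegrableB => //; exact: rintegrableZ.
have hE : (\int[mu]_x h x = M - 2 * e * A - 2 * c e * c e + c e ^+ 2)%R.
  rewrite /h RintegralD//; last 2 first.
  - apply: rintegrableB; last exact: rintegrableZ.
    by apply: rintegrableB => //; exact: rintegrableZ.
  - exact: rintegrable_cst.
  rewrite RintegralB//; last 2 first.
  - by apply: rintegrableB => //; exact: rintegrableZ.
  - exact: rintegrableZ.
  rewrite RintegralB//; last exact: rintegrableZ.
  rewrite Rintegral_cst// [X in fine X](_ : _ = 1%E) ?mulr1; last exact: probability_setT.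
  by rewrite !RintegralZl// -cE.
have : (\int[mu]_x h x <= \int[mu]_x ((Y e x - c e) ^+ 2))%R.
  apply: le_Rintegral => //; first exact: iYc.
  move=> x _; rewrite /h.
  have : X x ^+ 2 - 2 * e * X x <= Y e x ^+ 2.
    rewrite /Y; case: (leP (X x - e) 0) => Xe.
      by have := X0 x; nra.
    nra.
  nra.
have cc : c e * c e <= A * A by apply: ler_pM.
by rewrite hE !expr2; lra.
Qed.

End real_integrable.

Section poincare_energy.
Context {R : realType} (Phi : R -> R).
Hypothesis nPhi : nice_young Phi.
Hypothesis Phi2 : {in `]0, +oo[ &, {homo (fun x => Phi x / x ^+ 2) : x y / x <= y}}.
Variables (mu : probability (measurableTypeR R) R)
  (nu : {measure set (measurableTypeR R) -> \bar R}) (C : R).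
Hypothesis muC : poincare mu nu C.
Variable f : R -> R.
Hypothesis lf : locally_lipschitz f.

Lemma measurable_young_integrand : measurable_fun setT
  (fun x : R => young_mod Phi (abs_slope f x / f x) * f x ^+ 2).
Proof.
have mf : measurable_fun setT f.
  by apply: continuous_measurable_fun; exact: locally_lipschitz_continuous.
apply: measurable_funM; last exact: measurable_funX.
apply: measurableT_comp; first exact: (measurable_young_mod nPhi).
by apply: measurable_fun_div => //; exact: measurable_abs_slope.
Qed.

Lemma young_integrand_ge0 x : 0 <= young_mod Phi (abs_slope f x / f x) * f x ^+ 2.
Proof. by rewrite mulr_ge0 ?sqr_ge0//; exact: (young_mod_ge0 nPhi Phi2). Qed.

Lemma young_energy_ge0 : (0 <= young_energy nu Phi f)%E.
Proof. by apply: integral_ge0 => x _; rewrite lee_fin young_integrand_ge0. Qed.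

(** The sign of the constant is not prescribed. Tested on the identity, whose slope is at least 1, a
    negative constant forces [nu] to vanish, because a variance is nonnegative. *)
Lemma poincare_neg : C < 0 -> young_energy nu Phi f = 0%E.
Proof.
move=> C0.
have lid : locally_lipschitz (@idfun R).
  apply/locally_lipschitzP => x; exists 1, 1; split => // y z _ _.
  by rewrite mul1r.
have sid x : 1 <= abs_slope (@idfun R) x.
  rewrite leNgt; apply/negP => /(abs_slope_lt _ _ lid)[d d0 [k k1 H]].
  have := H (x + d); rewrite /= opprD addrA subrr sub0r normrN gtr0_norm// lexx.
  by move=> /(_ isT); rewrite leNgt => /negP; apply; rewrite gtr_pMl.
have nuT : nu setT = 0%E.
  apply/eqP; rewrite eq_le measure_ge0 andbT leNgt; apply/negP => nu0.
  have H := muC lid.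
  have I0 : (0 < \int[nu]_x (abs_slope idfun x ^+ 2)%:E)%E.
    apply: (lt_le_trans nu0); rewrite -[leLHS]mul1e -integral_cst//.
    apply: ge0_le_integral => //.
    - apply/measurable_EFinP; apply: measurable_funX.
      exact: measurable_abs_slope.
    - by move=> x _; rewrite lee_fin expr2; have := sid x; nra.
  have : (C%:E * \int[nu]_x (abs_slope idfun x ^+ 2)%:E < 0)%E by rewrite nmule_rlt0// lte_fin.
  by rewrite ltNge => /negP; apply; apply: le_trans H; exact: variance_ge0.
rewrite /young_energy; apply: null_set_integral => //.
by apply/measurable_EFinP; exact: measurable_young_integrand.
Qed.

Lemma poincare_energy_ge0 : (0 <= C%:E * young_energy nu Phi f)%E.
Proof.
have [C0|C0] := leP 0 C; first by rewrite mule_ge0// ?lee_fin// young_energy_ge0.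
by rewrite poincare_neg// mule0.
Qed.

(** The truncated function has slope 0 where |f| < e. Elsewhere f is nonzero, its slope bounds the
    truncated one, and (f')^2 = (f'/f)^2 f^2 is at most the energy integrand. *)
Lemma poincare_truncation e : 0 < e ->
  ('V_mu[fun x => Num.max (`|f x| - e)%R 0%R] <= C%:E * young_energy nu Phi f)%E.
Proof.
move=> e0.
have max1 a b : `|Num.max (`|a| - e) 0 - Num.max (`|b| - e) 0| <= `|a - b|.
  have := ler_dist_dist a b; rewrite !ler_norml.
  by case: (leP (`|a| - e) 0) => ?; case: (leP (`|b| - e) 0) => ? /andP[]; lra.
pose g x := Num.max (`|f x| - e) 0.
have lg : locally_lipschitz g.
  exact: (locally_lipschitz_comp (g := fun t => Num.max (`|t| - e) 0)).
have sgf x : abs_slope g x <= abs_slope f x.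
  by apply: (abs_slope_mono lf lg ltr01) => y _; exact: max1.
have sg0 x : `|f x| < e -> abs_slope g x = 0.
  move=> fxe; apply/eqP; rewrite eq_le abs_slope_ge0// andbT.
  have : \forall y \near x, `|f y| < e.
    have cf : {for x, continuous (fun y => `|f y|)}.
      by apply: cvg_norm; exact: locally_lipschitz_continuous.
    exact: (cvgr_lt _ cf).
  move=> /nbhs_ballP[d /= d0 dV].
  apply: (abs_slope_le lg d0) => y xy; have fye := dV _ xy.
  by rewrite mul0r /g !max_r ?subrr ?normr0// subr_le0 ltW.
have le_int : (\int[nu]_x (abs_slope g x ^+ 2)%:E <= young_energy nu Phi f)%E.
  apply: ge0_le_integral => //.
  - by move=> x _; rewrite lee_fin sqr_ge0.
  - by apply/measurable_EFinP; apply: measurable_funX; exact: measurable_abs_slope.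
  - by apply/measurable_EFinP; exact: measurable_young_integrand.
  - move=> x _; rewrite lee_fin.
    have [fe|ef] := ltP `|f x| e.
      by rewrite sg0// expr0n/=; exact: young_integrand_ge0.
    have fx0 : f x != 0 by rewrite -normr_gt0; exact: lt_le_trans ef.
    apply: (@le_trans _ _ (abs_slope f x ^+ 2)).
      by apply: lerXn2r; rewrite ?nnegrE ?abs_slope_ge0.
    rewrite -[leLHS](@divfK _ (f x ^+ 2)) ?expf_neq0// -expr_div_n.
    by rewrite ler_wpM2r ?sqr_ge0// sqr_le_young_mod.
have [C0|C0] := leP 0 C.
  by apply: le_trans (muC lg) _; apply: lee_wpmul2l; rewrite ?lee_fin.
rewrite poincare_neg// mule0; apply: le_trans (muC lg) _.
rewrite nmule_rle0 ?lte_fin//; apply: integral_ge0 => x _.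
by rewrite lee_fin sqr_ge0.
Qed.

End poincare_energy.

(** * Entropy of the square against the layers *)

Section entropy.
Context d (T : measurableType d) {R : realType} (mu : probability T R).
Variable f : T -> R.
Hypothesis mf : measurable_fun setT f.
Hypothesis if1 : rintegrable mu (fun x => `|f x|).
Hypothesis if2 : rintegrable mu (fun x => f x ^+ 2).
Let M := (\int[mu]_x (f x ^+ 2))%R.
Let A := (\int[mu]_x `|f x|)%R.
Let K := Num.sqrt M.

Let M0 : 0 <= M.
Proof. by apply: Rintegral_ge0 => x _; exact: sqr_ge0. Qed.

Let K2 : K ^+ 2 = M.
Proof. by rewrite sqr_sqrtr. Qed.

Let EntE : Ent mu (fun x => f x ^+ 2) =
  (\int[mu]_x (f x ^+ 2 * ln (f x ^+ 2))%:E - (M * ln M)%:E)%E.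
Proof. by rewrite /Ent (rintegralE if2). Qed.

Let int_const : (forall c : R, \int[mu]_x c = c)%R.
Proof.
by move=> c; rewrite Rintegral_cst// [X in fine X](_ : _ = 1%E) ?mulr1//; exact: probability_setT.
Qed.

Let i_dev : rintegrable mu (fun x => (`|f x| - K) ^+ 2).
Proof.
rewrite (_ : (fun x => _) = fun x => f x ^+ 2 - 2 * K * `|f x| + M).
  apply: rintegrableD; last exact: rintegrable_cst.
  by apply: rintegrableB => //; exact: rintegrableZ.
apply/funext => x; rewrite -K2 -[f x ^+ 2]real_normK ?num_real//; ring.
Qed.

Let int_dev : (\int[mu]_x ((`|f x| - K) ^+ 2) = 2 * (K * (K - A)))%R.
Proof.
rewrite (_ : (fun x => _) = fun x => f x ^+ 2 - 2 * K * `|f x| + M).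
  rewrite RintegralD//; last 2 first.
  - by apply: rintegrableB => //; exact: rintegrableZ.
  - exact: rintegrable_cst.
  rewrite RintegralB//; last exact: rintegrableZ.
  rewrite RintegralZl// int_const -/M -/A -K2; ring.
apply/funext => x; rewrite -K2 -[f x ^+ 2]real_normK ?num_real//; ring.
Qed.

(** The integral of (|f| - K)^2 is then 0, so |f| = K almost everywhere. This also covers K = 0,
    where f cannot be normalised. *)
Lemma Ent_sqr_const : K * (K - A) <= 0 -> Ent mu (fun x => f x ^+ 2) = 0%E.
Proof.
move=> KA.
have int0 : (\int[mu]_x `|((`|f x| - K) ^+ 2)%:E|)%E = 0%E.
  under eq_integral do rewrite /= ger0_norm ?sqr_ge0//.
  rewrite (rintegralE i_dev) int_dev; congr EFin.
  apply/eqP; rewrite eq_le; apply/andP; split; first lra.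
  by rewrite -int_dev; apply: Rintegral_ge0 => x _; exact: sqr_ge0.
have mdev : measurable_fun setT (fun x => ((`|f x| - K) ^+ 2)%:E).
  by apply/measurable_EFinP; exact: rintegrable_measurable i_dev.
have dev0 := (ae_eq_integral_abs mu measurableT mdev).1 int0.
have mf2 : measurable_fun setT (fun x => f x ^+ 2) by exact: measurable_funX.
rewrite EntE (ae_eq_integral (fun=> (M * ln M)%:E))//.
- by rewrite (rintegralE (rintegrable_cst _ _)) int_const subee.
- apply/measurable_EFinP; apply: measurable_funM => //.
  by apply: measurableT_comp => //; exact: measurable_ln.
- apply: filterS dev0 => x /(_ Logic.I)/= [] /eqP; rewrite expf_eq0/= subr_eq0 => /eqP fK _.
  by rewrite -[f x ^+ 2]real_normK ?num_real// fK K2.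
Qed.

Lemma Ent_sqr_le v : 0 < M -> K * (K - A) <= v ->
  (\int[mu]_x layers (`|f x| / K)%R < +oo)%E ->
  (Ent mu (fun x => (f x ^+ 2)%R) <= (66 * v)%:E + M%:E * \int[mu]_x layers (`|f x| / K)%R)%E.
Proof.
move=> Mgt0 KAv Pfin.
have K0 : 0 < K by rewrite sqrtr_gt0.
pose g x := `|f x| / K.
have g0 x : 0 <= g x by rewrite divr_ge0// ltW.
have mg : measurable_fun setT g.
  by apply: measurable_funM => //; exact: measurableT_comp.
have msqln : measurable_fun setT (@sqln R).
  by apply: measurable_funM => //; apply: measurableT_comp => //; exact: measurable_ln.
pose r x := sqln (g x) - g x ^+ 2 + 1 - 33 * (g x - 1) ^+ 2.
have mr : measurable_fun setT r.
  apply: measurable_funB.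
    apply: measurable_funD => //; apply: measurable_funB; first exact: measurableT_comp.
    exact: measurable_funX.
  by apply: measurable_funM => //; apply: measurable_funX; exact: measurable_funB.
pose h x := f x ^+ 2 * ln (f x ^+ 2).
(* What remains of [h] after removing [M * r]; its integral is M ln M + 66 K (K - A), and M ln M
   cancels the second term of the entropy. *)
pose U x := ln M * f x ^+ 2 + f x ^+ 2 - M + 33 * (`|f x| - K) ^+ 2.
have fg x : f x ^+ 2 = M * g x ^+ 2.
  by rewrite -[f x ^+ 2]real_normK ?num_real// /g expr_div_n K2 mulrC divfK// gt_eqF.
have hE x : h x = M * r x + U x.
  have -> : h x = M * sqln (g x) + ln M * f x ^+ 2.
    have [fx0|fx0] := eqVneq (f x) 0.
      by rewrite /h /sqln /g fx0 normr0 mul0r !expr0n/= !(mul0r,mulr0) addr0.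
    have gx0 : 0 < g x by rewrite divr_gt0// normr_gt0.
    by rewrite /h /sqln fg lnM ?posrE ?exprn_gt0//; ring.
  rewrite /U; have -> : `|f x| - K = K * (g x - 1).
    by rewrite mulrBr mulr1 mulrC divfK// gt_eqF.
  by rewrite /r [(K * _) ^+ 2]exprMn K2 fg; ring.
(* [layers] controls [r] only from above; this lower bound, through h = M r + U, makes [r]
   integrable. *)
have h1 x : -1 <= h x.
  rewrite /h; have [->|fx0] := eqVneq (f x) 0.
    by rewrite expr0n/= mul0r; lra.
  have f20 : 0 < f x ^+ 2 by rewrite exprn_even_gt0.
  have : ln (f x ^+ 2)^-1 <= (f x ^+ 2)^-1 - 1 by apply: ln_leB1; rewrite invr_gt0.
  rewrite lnV ?posrE// -(ler_pM2l f20) mulrBr mulfV ?gt_eqF//; lra.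
have iU : rintegrable mu U.
  apply: rintegrableD; last exact: rintegrableZ.
  apply: rintegrableB; last exact: rintegrable_cst.
  by apply: rintegrableD => //; exact: rintegrableZ.
have rG x : ((r x)%:E <= layers (g x))%E by exact: sqln_le_layers.
have G0 x : (0 <= layers (g x))%E by exact: layers_ge0.
pose rp x := Num.max (r x) 0.
have rp0 x : 0 <= rp x by rewrite le_max lexx orbT.
have int_rp : (\int[mu]_x (rp x)%:E <= \int[mu]_x layers (g x))%E.
  apply: ge0_integral_mono => x; first by rewrite lee_fin.
  by rewrite /rp maxEge; case: ifP.
have mrp : measurable_fun setT rp by exact: measurable_maxr.
have irp : rintegrable mu rp by apply: ge0_rintegrable => //; exact: le_lt_trans Pfin.
have ir : rintegrable mu r.
  apply: (@le_rintegrable _ _ _ _ _ (fun x => rp x + M^-1 * (1 + `|U x|))) => //.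
    move=> x; rewrite ler_norml; apply/andP; split; last first.
      rewrite (@le_trans _ _ (rp x))// ?le_max ?lexx// lerDl.
      by rewrite mulr_ge0 ?invr_ge0// addr_ge0.
    rewrite lerNl; apply: (@le_trans _ _ (M^-1 * (1 + `|U x|))); last by rewrite lerDr.
    rewrite ler_pdivlMl//; have := h1 x; rewrite hE.
    by have := ler_norm (U x); lra.
  apply: rintegrableD => //; apply: rintegrableZ; apply: rintegrableD.
    exact: rintegrable_cst.
  by have := integrable_norm iU.
have ih : rintegrable mu h.
  rewrite (_ : h = fun x => M * r x + U x); last exact/funext.
  by apply: rintegrableD => //; exact: rintegrableZ.
rewrite EntE (rintegralE ih).
have Ph : (\int[mu]_x layers (g x) \is a fin_num)%E.
  by rewrite ge0_fin_numE// integral_ge0.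
rewrite -(fineK Ph) -EFinB -EFinM -EFinD lee_fin.
have -> : (\int[mu]_x h x = M * \int[mu]_x r x + \int[mu]_x U x)%R.
  rewrite (_ : h = fun x => M * r x + U x); last exact/funext.
  by rewrite RintegralD//; [rewrite RintegralZl|exact: rintegrableZ].
have -> : (\int[mu]_x U x = M * ln M + 33 * (2 * (K * (K - A))))%R.
  rewrite /U RintegralD//; last 2 first.
  - apply: rintegrableB; last exact: rintegrable_cst.
    by apply: rintegrableD => //; exact: rintegrableZ.
  - exact: rintegrableZ.
  rewrite RintegralB//; last 2 first.
  - by apply: rintegrableD => //; exact: rintegrableZ.
  - exact: rintegrable_cst.
  rewrite RintegralD//; last exact: rintegrableZ.
  rewrite int_const !RintegralZl// int_dev -/M; ring.
have rle : (\int[mu]_x r x <= fine (\int[mu]_x layers (g x)))%R.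
  apply: (@le_trans _ _ (\int[mu]_x rp x)%R).
    by apply: le_Rintegral => // x _; rewrite le_max lexx.
  by rewrite -lee_fin -(rintegralE irp) fineK.
by have := ler_wpM2l M0 rle; lra.
Qed.

End entropy.

(** * Normalisation by the L2 norm *)

Section normalized.
Context {R : realType} (Phi : R -> R).
Hypothesis nPhi : nice_young Phi.
Hypothesis Phi2 : {in `]0, +oo[ &, {homo (fun x => Phi x / x ^+ 2) : x y / x <= y}}.
Variables (mu : probability (measurableTypeR R) R)
  (nu : {measure set (measurableTypeR R) -> \bar R}) (n : R -> R).
Hypotheses (mn : measurable_fun [set: measurableTypeR R] n) (n0 : forall x, 0 <= n x).
Hypothesis nuE : forall A : set (measurableTypeR R), measurable A ->
     nu A = (\int[lebesgue_measure]_(x in A) (n x)%:E)%E.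
Variable f : R -> R.
Hypothesis lf : locally_lipschitz f.
Variable K : R.
Hypothesis K0 : 0 < K.
Hypothesis fK : (\int[mu]_x (f x ^+ 2)%:E = (K ^+ 2)%:E)%E.
Local Notation leb := (@lebesgue_measure R).

Let g x := `|f x| / K.
Let s x := abs_slope f x / K.

Lemma young_modN z : young_mod Phi (- z) = young_mod Phi z.
Proof. by rewrite /young_mod normrN sqrrN. Qed.

Let cf : continuous f := locally_lipschitz_continuous lf.

Let cg : continuous g.
Proof. by move=> x; apply: cvgMr_tmp; apply: cvg_norm; exact: cf. Qed.

Let ms : measurable_fun setT s.
Proof. by apply: measurable_funM => //; exact: measurable_abs_slope. Qed.

Let s0 x : 0 <= s x.
Proof. by rewrite divr_ge0 ?abs_slope_ge0// ltW. Qed.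

Let gs a b : a <= b ->
  (`|g b - g a|%:E <= \int[leb]_(t in `]a, b[) (s t)%:E)%E.
Proof.
move=> ab; have K0' : 0 <= K^-1 by rewrite invr_ge0 ltW.
rewrite (_ : (\int[leb]_(t in `]a, b[) (s t)%:E =
    (K^-1)%:E * \int[leb]_(t in `]a, b[) (abs_slope f t)%:E)%E); last first.
  rewrite -ge0_integralZl//.
  - by apply: eq_integral => t _; rewrite -EFinM mulrC.
  - by apply: measurable_funTS; apply/measurable_EFinP; exact: measurable_abs_slope.
  - by move=> t _; rewrite lee_fin abs_slope_ge0.
apply: (@le_trans _ _ ((K^-1)%:E * `|f b - f a|%:E)%E).
  rewrite -EFinM lee_fin /g -mulrBl normrM [leLHS]mulrC (ger0_norm K0').
  by rewrite ler_wpM2l// ler_dist_dist.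
by apply: lee_wpmul2l; rewrite ?lee_fin//; exact: slope_integral.
Qed.

Let g_markov (c : R) : 0 < c -> (mu [set x | (c <= g x)%R] <= ((c ^+ 2)^-1)%:E)%E.
Proof.
move=> c0; set A := [set x | _].
have mA : measurable A by exact: measurable_superlevel.
have mf2 : measurable_fun setT (fun x => (f x ^+ 2)%:E).
  apply/measurable_EFinP; apply: measurable_funX; exact: continuous_measurable_fun.
have cK0 : 0 < (c * K) ^+ 2 by rewrite exprn_gt0// mulr_gt0.
have : (((c * K) ^+ 2)%:E * mu A <= (K ^+ 2)%:E)%E.
  rewrite -fK -integral_cst//.
  apply: (@le_trans _ _ (\int[mu]_(x in A) (f x ^+ 2)%:E)%E).
    apply: ge0_le_integral => //.
    - by move=> x _; rewrite lee_fin ltW.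
    - exact: measurable_funTS.
    - move=> x; rewrite /A /= /g ler_pdivlMr// => cg'.
      rewrite lee_fin -[leRHS]real_normK ?num_real//.
      by apply: lerXn2r; rewrite ?nnegrE// mulr_ge0// ltW.
  apply: ge0_subset_integral => //.
  by move=> x _; rewrite lee_fin sqr_ge0.
rewrite -lee_pdivlMl// -EFinM => /le_trans; apply.
by rewrite lee_fin exprMn invfM mulrAC -mulrA mulfV ?mulr1// expf_neq0// gt_eqF.
Qed.

(** The quotient of slope by function is unchanged by scaling, up to a sign that the even
    [young_mod] ignores, so the energy is homogeneous of degree 2. *)
Let energyE : ((K ^+ 2)%:E * \int[leb]_x (energy_density Phi g s n x)%:E)%E =
  young_energy nu Phi f.
Proof.
rewrite -ge0_integralZl//; last 3 first.
- apply/measurable_EFinP; apply: measurable_energy_density => //.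
  exact: continuous_measurable_fun.
- by move=> x _; rewrite lee_fin; exact: energy_density_ge0.
- by rewrite lee_fin sqr_ge0.
rewrite /young_energy (integral_density mn n0 nuE); last 2 first.
- exact: measurable_young_integrand.
- exact: young_integrand_ge0.
apply: eq_integral => x _; rewrite -EFinM /energy_density; congr EFin.
have -> : s x / g x = abs_slope f x / `|f x|.
  by rewrite /s /g invf_div mulrA divfK// gt_eqF.
have -> : young_mod Phi (abs_slope f x / `|f x|) = young_mod Phi (abs_slope f x / f x).
  by case: ger0P => // _; rewrite invrN mulrN young_modN.
rewrite /g expr_div_n real_normK ?num_real//.
by field; rewrite gt_eqF.
Qed.

Lemma layers_young_energy m B : median mu m ->
  (C_plus mu Phi n m <= B%:E)%E -> (C_minus mu Phi n m <= B%:E)%E ->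
  (young_energy nu Phi f < +oo)%E ->
  ((K ^+ 2)%:E * \int[mu]_x layers (`|f x| / K)%R <=
   (32 * Phi 1 * B)%:E * young_energy nu Phi f)%E.
Proof.
move=> mum CpB CmB; rewrite -energyE => Efin.
have K20 : 0 < K ^+ 2 by rewrite exprn_gt0.
have J0 : (0 <= \int[leb]_x (energy_density Phi g s n x)%:E)%E.
  by apply: integral_ge0 => x _; rewrite lee_fin; exact: energy_density_ge0.
rewrite muleCA lee_pmul2l//.
apply: (layer_integral nPhi Phi2 cg ms mn s0 n0 gs g_markov mum CpB CmB).
move: J0 Efin; case: (\int[leb]_x _)%E => [r _ _|_|//]; first exact: ltry.
by rewrite gt0_muley ?lte_fin.
Qed.

End normalized.

Lemma C_plus_ge0 {R : realType} (mu : probability (measurableTypeR R) R) Phi n m :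
  (0 <= C_plus mu Phi n m :> \bar R)%E.
Proof.
pose x := (m + 1)%R.
apply: (@le_trans _ _ ((xlogV (fine (mu `[x, +oo[%classic)))%:E *
   orlicz_norm (fun u => 2%:E * right_derive_inv Phi u) (indic_over `[m, x]%classic n))%E).
  rewrite mule_ge0//.
    rewrite lee_fin xlogV_ge0 ?fine_ge0//.
    by rewrite -lee_fin fineK ?fin_num_measure ?probability_le1.
  by apply/ereal_infP => _ [N [N0 _] <-]; rewrite lee_fin ltW.
by apply: ereal_sup_ubound; exists x => //=; rewrite ltrDl.
Qed.

Theorem theorem20 (R : realType) (theta : R) (Phi : R -> R)
  (mu : probability (measurableTypeR R) R) (m : R)
  (n : R -> R) (nu : {measure set (measurableTypeR R) -> \bar R}) (C_P : R) :
  2 <= theta ->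
  nice_young Phi ->
  strictly_convex Phi ->
  {in `]0, +oo[ &, {homo (fun x => Phi x / x ^+ 2) : x y / x <= y}} ->
  {in `]0, +oo[ &, {homo (fun x => Phi x / x `^ theta) : x y /~ x <= y}} ->
  median mu m ->
  measurable_fun [set: measurableTypeR R] n ->
  (forall x, 0 <= n x) ->
  (forall A : set (measurableTypeR R), measurable A ->
     nu A = (\int[lebesgue_measure]_(x in A) (n x)%:E)%E) ->
  poincare mu nu C_P ->
  forall f : R -> R, locally_lipschitz f ->
    (Ent mu (fun x => (f x ^+ 2)%R)
      <= ((235 * C_P)%:E
          + (16 * theta * Phi 1)%:E
            * Order.max (C_minus mu Phi n m) (C_plus mu Phi n m))
         * young_energy nu Phi f)%E.
Proof.
move=> theta2 nPhi _ Phi2 _ mum mn n0 nuE muC f lf.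
set E := young_energy nu Phi f; set Q := Order.max _ _.
have E0 : (0 <= E)%E by exact: young_energy_ge0.
have CE0 : (0 <= C_P%:E * E)%E by exact: (poincare_energy_ge0 nPhi Phi2 muC lf).
have Q0 : (0 <= Q)%E by rewrite le_max; apply/orP; right; exact: C_plus_ge0.
have P10 : 0 < Phi 1 by apply: young_gt0 => //; exact: oner_neq0.
have th0 : 0 < theta by apply: lt_le_trans theta2.
have w0 : 0 < 16 * theta * Phi 1 by rewrite !mulr_gt0.
have X0 : (0 <= (16 * theta * Phi 1)%:E * Q)%E by rewrite mule_ge0// lee_fin ltW.
have neg : C_P < 0 -> E = 0%E by exact: (poincare_neg nPhi muC lf).
(* An infinite product forces C_P > 0 and E = +oo, so the right-hand side is infinite. *)
have [CEy|CEy] := eqVneq (C_P%:E * E)%E +oo%E.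
  have C0 : 0 < C_P.
    rewrite ltNge; apply/negP; rewrite le_eqVlt => /predU1P[C0|/neg E0'].
      by move: CEy; rewrite C0 mul0e.
    by move: CEy; rewrite E0' mule0.
  have infty (e : \bar R) : (0 <= e -> C_P%:E * e = +oo -> e = +oo)%E.
    by case: e.
  rewrite (infty _ E0 CEy).
  rewrite gt0_muley ?leey// (@lt_le_trans _ _ (235 * C_P)%:E)//.
    by rewrite lte_fin mulr_gt0.
  by rewrite leeDl.
have mf : measurable_fun [set: measurableTypeR R] f.
  by apply: continuous_measurable_fun; exact: locally_lipschitz_continuous.
have CEf : (C_P%:E * E)%E \is a fin_num by rewrite ge0_fin_numE// lt_neqAle CEy leey.
set v := fine (C_P%:E * E)%E.
have vE : (C_P%:E * E = v%:E)%E by rewrite fineK.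
have v0 : 0 <= v by rewrite fine_ge0.
(* This gives f in L2, so the value +oo that [Ent] takes on non-integrable functions does not
   arise. *)
have [||e e0|if1 if2' Mv] := @second_moment_truncation _ _ _ mu (fun x => `|f x|) v.
- exact: measurableT_comp.
- by move=> x.
- by rewrite -vE; exact: (poincare_truncation nPhi Phi2 muC lf).
have if2 : rintegrable mu (fun x => f x ^+ 2).
  move: if2'; rewrite (_ : (fun x => `|f x| ^+ 2) = (fun x => f x ^+ 2))//.
  by apply/funext => x; rewrite real_normK ?num_real.
move: Mv; rewrite (_ : (fun x => `|f x| ^+ 2) = (fun x => f x ^+ 2)); last first.
  by apply/funext => x; rewrite real_normK ?num_real.
set M := (\int[mu]_x (f x ^+ 2))%R; set A := (\int[mu]_x `|f x|)%R => Mv.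
have M0 : 0 <= M by apply: Rintegral_ge0 => x _; exact: sqr_ge0.
have A0 : 0 <= A by exact: Rintegral_ge0.
pose K := Num.sqrt M.
have K0 : 0 <= K by exact: sqrtr_ge0.
have K2 : K ^+ 2 = M by rewrite sqr_sqrtr.
(* For A <= K, K (K - A) <= (K + A) (K - A), which is the variance of |f|; for A > K the left side
   is at most 0. *)
have KA : K * (K - A) <= v.
  by have [KA|AK] := leP K A; [nra|move: Mv; rewrite -K2; nra].
have RHS0 : (0 <= ((235 * C_P)%:E + (16 * theta * Phi 1)%:E * Q) * E)%E.
  have [C0|/neg ->] := leP 0 C_P; last by rewrite mule0.
  by rewrite mule_ge0// adde_ge0// lee_fin mulr_ge0.
have [KA0|KAgt0] := leP (K * (K - A)) 0; first by rewrite Ent_sqr_const.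
have vgt0 : 0 < v by exact: lt_le_trans KA.
have Kgt0 : 0 < K.
  by rewrite lt_neqAle K0 andbT; apply/eqP => K00; move: KAgt0; rewrite -K00 mul0r ltxx.
have Mgt0 : 0 < M by rewrite -K2 exprn_gt0.
have C0 : 0 < C_P.
  rewrite ltNge; apply/negP; rewrite le_eqVlt => /predU1P[C0|/neg E0'].
    by move: vgt0; rewrite /v C0 mul0e ltxx.
  by move: vgt0; rewrite /v E0' mule0 ltxx.
have Ef : E \is a fin_num.
  have finite (e : \bar R) : (0 <= e -> C_P%:E * e != +oo -> e \is a fin_num)%E.
    by case: e => //; rewrite gt0_muley ?lte_fin.
  exact: finite.
have Egt0 : (0 < E)%E.
  by rewrite lt0e E0 andbT; apply/eqP => E00; move: vgt0; rewrite /v E00 mule0 ltxx.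
have [Qy|Qy] := eqVneq Q +oo%E.
  by rewrite Qy gt0_muley ?lte_fin// addey// gt0_mulye// leey.
have Qf : Q \is a fin_num by rewrite ge0_fin_numE// lt_neqAle Qy leey.
pose B := fine Q.
have B0 : 0 <= B by rewrite fine_ge0.
have QB : Q = B%:E by rewrite fineK.
have CpB : (C_plus mu Phi n m <= B%:E)%E by rewrite -QB le_max; apply/orP; right.
have CmB : (C_minus mu Phi n m <= B%:E)%E by rewrite -QB le_max; apply/orP; left.
have Eoo : (E < +oo)%E by rewrite ltey_eq Ef.
have fK : (\int[mu]_x (f x ^+ 2)%:E = (K ^+ 2)%:E)%E by rewrite K2 (rintegralE if2).
have LE := layers_young_energy nPhi Phi2 mn n0 nuE lf Kgt0 fK mum CpB CmB Eoo.
have Lfin : (\int[mu]_x layers (`|f x| / K)%R < +oo)%E.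
  rewrite ltNge leye_eq; apply/negP => /eqP Ly.
  move: LE; rewrite Ly gt0_muley ?lte_fin ?exprn_gt0// leye_eq -/E -(fineK Ef).
  by rewrite -EFinM.
have EL := Ent_sqr_le mf if1 if2 Mgt0 KA Lfin.
apply: le_trans EL _.
apply: (@le_trans _ _ ((66 * v)%:E + (32 * Phi 1 * B)%:E * E)%E).
  by rewrite leeD2l//; move: LE; rewrite K2.
have [e Ee] : exists e, E = e%:E by exists (fine E); rewrite fineK.
have Ev : v = C_P * e by rewrite /v Ee.
rewrite Ev QB Ee. rewrite -!EFinM -!EFinD lee_fin.
have e0 : 0 < e by rewrite -lte_fin -Ee.
have H1 : 0 <= C_P * e by rewrite mulr_ge0// ltW.
have H2 : 0 <= (theta - 2) * (Phi 1 * B * e).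
  by rewrite mulr_ge0 ?subr_ge0// !mulr_ge0// ltW.
(* The slack in the constants: 169 = 235 - 66, and 16 theta - 32 is nonnegative because theta >=
   2. *)
rewrite -subr_ge0 (_ : _ - _ = 169 * (C_P * e) + 16 * ((theta - 2) * (Phi 1 * B * e))); last by ring.
by rewrite addr_ge0// mulr_ge0.
Qed.
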